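(* Let $k$ be a field of characteristic zero, $n\geq 1$, and $A\in\operatorname{GL}_n(k(z))$. Set $X=\mathbb{A}^1_k\times\operatorname{GL}_{n,k}$ and define a rational map $\sigma\colon X\dashrightarrow X$ by $$\sigma(b,B)=(b+1,\,A(b)B).$$ Then the following statements are equivalent: (i) For every $x=(b,B)\in X(k)$ with $b\in\mathbb{N}$ and $\mathcal{O}_\sigma(x)$ defined, and for every closed subvariety $Y\subset X$, the set $\{i\in\mathbb{N} \mid \sigma^i(x)\in Y\}$ is a finite union of arithmetic progressions. (ii) There exists a point $x=(b,B)\in X(k)$ with $b\in\mathbb{N}$ and $\mathcal{O}_\sigma(x)$ defined such that for every closed subvariety $Y\subset X$ the set $\{i\in\mathbb{N} \mid \sigma^i(x)\in Y\}$ is a finite union of arithmetic progressions. (iii) There exists a Picard-Vessiot extension of $k(z)$ for $\sigma(y)=Ay$ inside $\operatorname{Seq}_k$.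
   Context: $\mathbb{N}=\{0,1,2,\ldots\}$ (regarded as a subset of $k$ when needed). An arithmetic progression is a subset of $\mathbb{N}$ of the form $j+\mathbb{N}l$ with $j,l\in\mathbb{N}$ ($l=0$ allowed, so singletons are arithmetic progressions; the empty set is the empty union). Orbits: for a rational map $\sigma\colon X\dashrightarrow X$, let $U\subset X$ be the largest open subset on which $\sigma$ is defined; $\mathcal{O}_\sigma(x)$ is defined if $x\in U,\ \sigma(x)\in U,\ \sigma^2(x)\in U,\ldots$. (For the map above this means that for $x=(b,B)$ and every $i\in\mathbb{N}$, no entry of $A$ has a pole at $b+i$ and $\det(A)(b+i)\neq 0$.) A closed subvariety $Y\subset X$ is the zero locus in $X$ of a finite set of elements of the coordinate ring $k[z,Z_{ij},\frac{1}{\det(Z)}]$ of $X$; it need not be irreducible. Difference algebra: all rings are commutative. A $\sigma$-ring is a ring $R$ with a ring endomorphism $\sigma\colon R\to R$; morphisms of $\sigma$-rings commute with $\sigma$; a $\sigma$-field is a $\sigma$-ring that is a field; $R^\sigma=\{r\in R\mid \sigma(r)=r\}$. The field $k(z)$ is a $\sigma$-field via the automorphism $\sigma(h(z))=h(z+1)$. A $\sigma$-pseudo field is a $\sigma$-ring $L$ for which there exist orthogonal idempotents $e_0,\ldots,e_{l-1}\in L$ with $L=e_0L\oplus\cdots\oplus e_{l-1}L$, $\sigma(e_0)=e_1,\ \sigma(e_1)=e_2,\ldots,\sigma(e_{l-1})=e_0$, and each $e_iL$ a field. Let $K$ be a $\sigma$-field and $A\in\operatorname{GL}_n(K)$. A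 $\sigma$-pseudo field extension $L$ of $K$ is a Picard-Vessiot extension for $\sigma(y)=Ay$ if (1) there is $Y\in\operatorname{GL}_n(L)$ with $\sigma(Y)=AY$ such that $L$ is the total ring of fractions of $K[Y_{ij}]$ (written $L=K(Y_{ij})$), and (2) $L^\sigma=K^\sigma$. $\operatorname{Seq}_k$ is the ring of sequences $f\colon\mathbb{N}\to k$ modulo the identification of $f$ and $g$ if $f(i)=g(i)$ for all $i\gg 0$, with componentwise addition and multiplication, and with $\sigma(f)=(f(1),f(2),\ldots)$. The map $k(z)\to\operatorname{Seq}_k$, $h\mapsto(h(0),h(1),h(2),\ldots)$ (well defined since $h$ has finitely many poles) makes $\operatorname{Seq}_k$ a $k(z)$-$\sigma$-algebra. ''Inside $\operatorname{Seq}_k$'' means a $k(z)$-$\sigma$-subalgebra of $\operatorname{Seq}_k$. *)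

(* Defs.v *)
From HB Require Import structures.
From mathcomp Require Import all_boot all_order all_algebra.
From mathcomp Require Import fraction generic_quotient ring_quotient.
From mathcomp Require Import boolp classical_sets functions.
From mathcomp Require Import mpoly.

Set Implicit Arguments.
Unset Strict Implicit.
Unset Printing Implicit Defensive.

Import GRing.Theory.
Local Open Scope ring_scope.
Local Open Scope quotient_scope.

HB.mixin Record isDifference R of GRing.ComNzRing R := {
  dsigma : R -> R;
  dsigma_is_zmod_morphism : zmod_morphism dsigma;
  dsigma_is_monoid_morphism : monoid_morphism dsigma
}.

#[short(type="diffRingType")]
HB.structure Definition DiffRing := {R of GRing.ComNzRing R & isDifference R}.

#[short(type="diffFieldType")]
HB.structure Definition DiffField := {R of GRing.Field R & isDifference R}.

HB.instance Definition _ (R : diffRingType) :=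
  GRing.isZmodMorphism.Build R R dsigma dsigma_is_zmod_morphism.
HB.instance Definition _ (R : diffRingType) :=
  GRing.isMonoidMorphism.Build R R dsigma dsigma_is_monoid_morphism.

Record diffAlg (K : diffFieldType) := DiffAlg {
  diffalg_ring :> diffRingType;
  diffalg_map : {rmorphism K -> diffalg_ring};
  diffalg_mapS : forall c, diffalg_map (dsigma c) = dsigma (diffalg_map c)
}.

Section SubDiffAlg.
Variables (K : diffFieldType) (M : diffAlg K).

Record subDiffAlg := SubDiffAlg {
  sda_pred :> {pred M};
  sda_subring : subring_closed sda_pred;
  sda_map : forall c, diffalg_map M c \in sda_pred;
  sda_sigma : forall x, x \in sda_pred -> dsigma x \in sda_pred
}.

Variable S : subDiffAlg.

HB.instance Definition _ :=
  GRing.isSubringClosed.Build M (sda_pred S) (sda_subring S).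

Record sda_sort := SdaElt { sda_val :> M; sda_valP : sda_val \in sda_pred S }.

HB.instance Definition _ := [isSub for sda_val].
HB.instance Definition _ := [Choice of sda_sort by <:].
HB.instance Definition _ := [SubChoice_isSubComNzRing of sda_sort by <:].

Definition sda_sigma_fun (x : sda_sort) : sda_sort :=
  SdaElt (sda_sigma (sda_valP x)).

Lemma sda_sigma_zmod : zmod_morphism sda_sigma_fun.
Proof. by move=> x y; apply: val_inj; rewrite /= !raddfB. Qed.

Lemma sda_sigma_monoid : monoid_morphism sda_sigma_fun.
Proof.
by split=> [|x y]; apply: val_inj; rewrite /= ?(rmorph1, rmorphM).
Qed.

HB.instance Definition _ :=
  isDifference.Build sda_sort sda_sigma_zmod sda_sigma_monoid.

Definition sda_map_fun (c : K) : sda_sort := SdaElt (sda_map S c).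

Lemma sda_map_zmod : zmod_morphism sda_map_fun.
Proof. by move=> x y; apply: val_inj; rewrite /= !raddfB. Qed.

Lemma sda_map_monoid : monoid_morphism sda_map_fun.
Proof.
by split=> [|x y]; apply: val_inj; rewrite /= ?(rmorph1, rmorphM).
Qed.

HB.instance Definition _ :=
  GRing.isZmodMorphism.Build K sda_sort sda_map_fun sda_map_zmod.
HB.instance Definition _ :=
  GRing.isMonoidMorphism.Build K sda_sort sda_map_fun sda_map_monoid.

Lemma sda_mapS c : sda_map_fun (dsigma c) = dsigma (sda_map_fun c).
Proof. by apply: val_inj; rewrite /= diffalg_mapS. Qed.

Definition diffAlg_of_sub : diffAlg K := @DiffAlg K sda_sort sda_map_fun sda_mapS.

End SubDiffAlg.

Coercion diffAlg_of_sub : subDiffAlg >-> diffAlg.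

Definition principal_ideal (R : comNzRingType) (e : R) : set R :=
  [set x | exists y, x = e * y]%classic.

(* [e R], seen as a ring with unit [e], is a field. *)
Definition ideal_is_field (R : comNzRingType) (e : R) : Prop :=
  e <> 0 /\
  forall x, principal_ideal e x -> x <> 0 ->
    exists2 y, principal_ideal e y & x * y = e.

(* [ordS i] is the successor of [i] modulo [l]; as [0 != 1] in [L], the direct
   sum decomposition forces [l] to be positive. *)
Definition pseudo_field (L : diffRingType) : Prop :=
  exists (l : nat) (e : 'I_l -> L),
    [/\ (forall i, e i * e i = e i),
        (forall i j, i != j -> e i * e j = 0),
        (forall x : L, exists! f : {ffun 'I_l -> L},
           (forall i, principal_ideal (e i) (f i)) /\ x = \sum_(i < l) f i),
        (forall i, dsigma (e i) = e (ordS i)) &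
        (forall i, ideal_is_field (e i))].

(* The subring K[Y_ij] of L; [mxvec] numbers the n^2 entries of [Y]. *)
Definition adjoin_entries (K : diffFieldType) (L : diffAlg K) (n : nat)
    (Y : 'M[L]_n) : set L :=
  [set x | exists P : {mpoly K[n * n]},
     x = mmap (diffalg_map L) (fun i => mxvec Y 0 i) P]%classic.

Definition nonzerodivisor_in (L : comNzRingType) (S : set L) (s : L) : Prop :=
  S s /\ forall r, S r -> r * s = 0 -> r = 0.

Definition is_total_fractions (L : comNzRingType) (S : set L) : Prop :=
  (forall s, nonzerodivisor_in S s -> exists t, s * t = 1) /\
  (forall x, exists r s, [/\ S r, nonzerodivisor_in S s & x * s = r]).

Definition mx_invertible (R : comNzRingType) (n : nat) (Y : 'M[R]_n) : Prop :=
  exists Z : 'M[R]_n, Y *m Z = 1%:M /\ Z *m Y = 1%:M.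

Definition is_Picard_Vessiot (K : diffFieldType) (n : nat) (A : 'M[K]_n)
    (L : diffAlg K) : Prop :=
  [/\ pseudo_field L,
      (exists Y : 'M[L]_n,
         [/\ mx_invertible Y,
             map_mx dsigma Y = map_mx (diffalg_map L) A *m Y &
             is_total_fractions (adjoin_entries Y)]) &
      (forall x : L, dsigma x = x <->
         exists2 c : K, dsigma c = c & x = diffalg_map L c)].

Notation ratfun k := {fraction {poly k}}.

Section RatFun.
Variable k : fieldType.
Implicit Types (p q : {poly k}) (h : ratfun k) (b : k).

Local Notation "x %:F" := (@FracField.tofrac {poly k} x).

(* Coprime numerator and denominator of [h]. *)
Definition rat_num h : {poly k} :=
  \n_(repr h) %/ gcdp \n_(repr h) \d_(repr h).
Definition rat_den h : {poly k} :=
  \d_(repr h) %/ gcdp \n_(repr h) \d_(repr h).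

Definition regular_at h b : Prop := (rat_den h).[b] != 0.

(* Takes the junk value [0] at the poles of [h]. *)
Definition rat_eval h b : k := (rat_num h).[b] / (rat_den h).[b].

Lemma fractionE h : h = (\n_(repr h))%:F / (\d_(repr h))%:F.
Proof.
rewrite -[LHS]reprK; unlock FracField.tofrac.
rewrite -[X in _ = _ * X]FracField.pi_inv -[RHS]FracField.pi_mul; congr (\pi _).
rewrite /FracField.mulf /FracField.invf !numden_Ratio ?oner_neq0 ?denom_ratioP ?mulr1 //.
by rewrite mul1r Ratio_numden.
Qed.

Lemma gcd_repr_neq0 h : gcdp \n_(repr h) \d_(repr h) != 0.
Proof. by rewrite gcdp_eq0 negb_and (denom_ratioP (repr h)) orbT. Qed.

Lemma rat_den_neq0 h : rat_den h != 0.
Proof.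
have := denom_ratioP (repr h).
rewrite -[\d_(repr h) in X in X -> _](divpK (dvdp_gcdr \n_(repr h) _)).
by rewrite mulf_eq0 negb_or => /andP[].
Qed.

Lemma ratE h : h = (rat_num h)%:F / (rat_den h)%:F.
Proof.
rewrite [LHS]fractionE.
rewrite -[\n_(repr h) in LHS](divpK (dvdp_gcdl _ \d_(repr h))).
rewrite -[\d_(repr h) in X in _ / X](divpK (dvdp_gcdr \n_(repr h) _)).
rewrite !tofracM -mulf_div divff ?mulr1 // tofrac_eq0; exact: gcd_repr_neq0.
Qed.

Lemma coprimep_rat h : coprimep (rat_num h) (rat_den h).
Proof.
by apply: coprimep_div_gcd; rewrite (denom_ratioP (repr h)) orbT.
Qed.

Lemma eq_ratE p q h : q != 0 -> h = p%:F / q%:F ->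
  p * rat_den h = rat_num h * q.
Proof.
move=> q0 hE; apply/eqP; rewrite -tofrac_eq !tofracM.
rewrite -eqr_div ?tofrac_eq0 ?rat_den_neq0 //.
by rewrite -hE -ratE.
Qed.

Lemma regular_atP h b :
  regular_at h b <-> exists p q, q.[b] != 0 /\ h = p%:F / q%:F.
Proof.
split=> [hb|[p [q [qb hE]]]].
  by exists (rat_num h), (rat_den h); split=> //; exact: ratE.
have q0 : q != 0 by apply: contraNneq qb => ->; rewrite horner0.
have E := eq_ratE q0 hE.
have /dvdpP[r qE] : rat_den h %| q.
  by rewrite -(@Gauss_dvdpr _ _ (rat_num h)) -?E ?dvdp_mull // coprimep_sym coprimep_rat.
by move: qb; rewrite qE hornerM mulf_eq0 negb_or => /andP[].
Qed.

Lemma rat_evalE p q h b : q.[b] != 0 -> h = p%:F / q%:F ->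
  rat_eval h b = p.[b] / q.[b].
Proof.
move=> qb hE.
have q0 : q != 0 by apply: contraNneq qb => ->; rewrite horner0.
have hb : (rat_den h).[b] != 0 by apply/regular_atP; exists p, q.
have /(congr1 (horner^~ b)) /= := eq_ratE q0 hE.
by rewrite !hornerM /rat_eval => E; apply/eqP; rewrite eqr_div // E.
Qed.

Lemma rat_evalB h1 h2 b : regular_at h1 b -> regular_at h2 b ->
  rat_eval (h1 - h2) b = rat_eval h1 b - rat_eval h2 b.
Proof.
move=> r1 r2.
rewrite (@rat_evalE (rat_num h1 * rat_den h2 - rat_num h2 * rat_den h1)
  (rat_den h1 * rat_den h2)).
- by rewrite hornerD hornerN !hornerM /rat_eval -[X in _ = _ + X]mulNr addf_div // mulNr.
- by rewrite hornerM mulf_neq0.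
- rewrite {1}[h1]ratE {1}[h2]ratE -mulNr addf_div ?tofrac_eq0 ?rat_den_neq0 //.
  by rewrite tofracB !tofracM mulNr.
Qed.

Lemma rat_evalM h1 h2 b : regular_at h1 b -> regular_at h2 b ->
  rat_eval (h1 * h2) b = rat_eval h1 b * rat_eval h2 b.
Proof.
move=> r1 r2.
rewrite (@rat_evalE (rat_num h1 * rat_num h2) (rat_den h1 * rat_den h2)).
- by rewrite !hornerM /rat_eval mulf_div.
- by rewrite hornerM mulf_neq0.
- by rewrite {1}[h1]ratE {1}[h2]ratE mulf_div !tofracM.
Qed.

Lemma rat_eval1 b : rat_eval 1 b = 1.
Proof.
by rewrite (@rat_evalE 1 1) ?hornerC ?oner_neq0 ?divr1 // tofrac1 divr1.
Qed.

Definition translate p : {poly k} := p \Po ('X + 1).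

Lemma translate_neq0 p : p != 0 -> translate p != 0.
Proof. by rewrite /translate comp_poly_eq0 // size_XaddC. Qed.

Definition rat_sigma h : ratfun k :=
  (translate (rat_num h))%:F / (translate (rat_den h))%:F.

Lemma rat_sigmaE p q : q != 0 ->
  rat_sigma (p%:F / q%:F) = (translate p)%:F / (translate q)%:F.
Proof.
move=> q0; have /(congr1 translate) := eq_ratE q0 (erefl (p%:F / q%:F)).
rewrite /translate !rmorphM /= => E; apply/eqP.
rewrite eqr_div ?tofrac_eq0 ?translate_neq0 ?rat_den_neq0 //.
by rewrite -!tofracM tofrac_eq -E.
Qed.

Lemma rat_sigma_zmod : zmod_morphism rat_sigma.
Proof.
move=> h1 h2.
have -> : h1 - h2 = (rat_num h1 * rat_den h2 - rat_num h2 * rat_den h1)%:F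
    / (rat_den h1 * rat_den h2)%:F.
  rewrite {1}[h1]ratE {1}[h2]ratE -mulNr addf_div ?tofrac_eq0 ?rat_den_neq0 //.
  by rewrite tofracB !tofracM mulNr.
rewrite rat_sigmaE ?mulf_neq0 ?rat_den_neq0 // /rat_sigma -[X in _ = _ + X]mulNr.
rewrite addf_div ?tofrac_eq0 ?translate_neq0 ?rat_den_neq0 //.
by rewrite /translate rmorphB !rmorphM /= mulNr rmorphB /= !rmorphM.
Qed.

Lemma rat_sigma_monoid : monoid_morphism rat_sigma.
Proof.
split=> [|h1 h2].
  have -> : (1 : ratfun k) = 1%:F / 1%:F by rewrite tofrac1 divr1.
  by rewrite rat_sigmaE ?oner_neq0 // /translate rmorph1.
have -> : h1 * h2 = (rat_num h1 * rat_num h2)%:F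
    / (rat_den h1 * rat_den h2)%:F.
  by rewrite {1}[h1]ratE {1}[h2]ratE mulf_div !tofracM.
rewrite rat_sigmaE ?mulf_neq0 ?rat_den_neq0 // /rat_sigma mulf_div.
by rewrite /translate !rmorphM.
Qed.

HB.instance Definition _ :=
  isDifference.Build {fraction {poly k}} rat_sigma_zmod rat_sigma_monoid.

Lemma rat_eval_sigma h b : regular_at h (b + 1) ->
  rat_eval (rat_sigma h) b = rat_eval h (b + 1).
Proof.
move=> r; rewrite (@rat_evalE (translate (rat_num h)) (translate (rat_den h))) //.
  by rewrite /translate !horner_comp !hornerE.
by rewrite /translate !horner_comp !hornerE.
Qed.

Lemma poly_nat_neq0 (k0 : [pchar k] =i pred0) q : q != 0 ->
  exists N, forall i : nat, (N <= i)%N -> q.[i%:R] != 0.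
Proof.
have [n] := ubnP (size q); elim: n q => // n IHn q; rewrite ltnS => qn q0.
have [[i /factor_theorem[r qE]]|qn0] := pselect (exists i : nat, root q i%:R).
  have r0 : r != 0 by apply: contraNneq q0 => r0; rewrite qE r0 mul0r.
  have [|N hN] := IHn r _ r0.
    by move: qn; rewrite qE size_Mmonic ?monicXsubC // size_XsubC addn2.
  exists (maxn N i.+1) => j; rewrite geq_max => /andP[/hN rj ij].
  rewrite qE hornerM mulf_neq0 // hornerXsubC -natrB 1?ltnW //.
  by rewrite ((pcharf0P _).1 k0) subn_eq0 -ltnNge.
by exists 0%N => i _; apply/negP => qi; apply: qn0; exists i.
Qed.

Lemma regular_nat (k0 : [pchar k] =i pred0) h :
  exists N, forall i : nat, (N <= i)%N -> regular_at h i%:R.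
Proof. by have := poly_nat_neq0 k0 (rat_den_neq0 h). Qed.

End RatFun.

Arguments regular_at {k} h b.
Arguments rat_eval {k} h b.

Section Seq.
Variable k : fieldType.

Definition eventually_zero : {pred nat -> k} :=
  fun f => `[< exists N, forall i, (N <= i)%N -> f i = 0 >].

Lemma eventually_zero_idealr : idealr_closed eventually_zero.
Proof.
split.
- by apply/asboolP; exists 0%N.
- apply/asboolP => -[N /(_ N (leqnn N))] /eqP; by rewrite oner_eq0.
- move=> a u v /asboolP[N1 h1] /asboolP[N2 h2]; apply/asboolP.
  exists (maxn N1 N2) => i; rewrite geq_max => /andP[/h1 ui /h2 vi].
  by rewrite /GRing.add /= /GRing.mul /= ui vi mulr0 addr0.
Qed.

HB.instance Definition _ :=
  isIdealr.Build (nat -> k) eventually_zero eventually_zero_idealr.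

Definition SeqRing := {ideal_quot eventually_zero}.
HB.instance Definition _ := GRing.ComNzRing.on SeqRing.
HB.instance Definition _ := EqQuotient.on SeqRing.

Definition seq_class (f : nat -> k) : SeqRing := \pi f.

Lemma seq_classP f g :
  seq_class f = seq_class g <-> exists N, forall i, (N <= i)%N -> f i = g i.
Proof.
split=> [/eqP|[N fg]].
  rewrite -Quotient.idealrBE => /asboolP[N fg]; exists N => i /fg.
  by move/subr0_eq.
apply/eqP; rewrite -Quotient.idealrBE; apply/asboolP; exists N => i /fg E.
by apply/eqP; rewrite subr_eq0; apply/eqP.
Qed.

Lemma seq_classB f g : seq_class (f - g) = seq_class f - seq_class g.
Proof. exact: (rmorphB (\pi_{ideal_quot eventually_zero})). Qed.

Lemma seq_classM f g : seq_class (f * g) = seq_class f * seq_class g.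
Proof. exact: (rmorphM (\pi_{ideal_quot eventually_zero})). Qed.

Lemma seq_class1 : seq_class 1 = 1.
Proof. exact: (rmorph1 (\pi_{ideal_quot eventually_zero})). Qed.

Definition seq_repr (s : SeqRing) : nat -> k := repr s.

Lemma seq_reprK s : seq_class (seq_repr s) = s.
Proof. exact: reprK. Qed.

Definition seq_sigma (s : SeqRing) : SeqRing :=
  seq_class (fun i => seq_repr s i.+1).

Lemma seq_sigmaE f : seq_sigma (seq_class f) = seq_class (fun i => f i.+1).
Proof.
have /seq_classP[N E] := seq_reprK (seq_class f).
by apply/seq_classP; exists N => i Ni; rewrite E // leqW.
Qed.

Lemma seq_sigma_zmod : zmod_morphism seq_sigma.
Proof.
move=> s t; rewrite -(seq_reprK s) -(seq_reprK t) -seq_classB !seq_sigmaE.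
by rewrite -seq_classB.
Qed.

Lemma seq_sigma_monoid : monoid_morphism seq_sigma.
Proof.
split=> [|s t]; first by rewrite -seq_class1 seq_sigmaE.
rewrite -(seq_reprK s) -(seq_reprK t) -seq_classM !seq_sigmaE.
by rewrite -seq_classM.
Qed.

HB.instance Definition _ :=
  isDifference.Build SeqRing seq_sigma_zmod seq_sigma_monoid.

(* In characteristic zero [h] has finitely many poles among the [i%:R], so the
   junk values of [rat_eval] do not affect the class. *)
Definition rat_seq (h : ratfun k) : SeqRing :=
  seq_class (fun i => rat_eval h i%:R).

Hypothesis k0 : [pchar k] =i pred0.

Lemma rat_seq_zmod : zmod_morphism rat_seq.
Proof.
move=> h1 h2; rewrite /rat_seq -seq_classB; apply/seq_classP.
have [N1 r1] := regular_nat k0 h1; have [N2 r2] := regular_nat k0 h2.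
exists (maxn N1 N2) => i; rewrite geq_max => /andP[/r1 ? /r2 ?].
by rewrite rat_evalB.
Qed.

Lemma rat_seq_monoid : monoid_morphism rat_seq.
Proof.
split=> [|h1 h2]; rewrite /rat_seq.
  rewrite -seq_class1; apply/seq_classP; exists 0%N => i _; exact: rat_eval1.
rewrite -seq_classM; apply/seq_classP.
have [N1 r1] := regular_nat k0 h1; have [N2 r2] := regular_nat k0 h2.
exists (maxn N1 N2) => i; rewrite geq_max => /andP[/r1 ? /r2 ?].
by rewrite rat_evalM.
Qed.

Definition rat_seq_rmorphism : {rmorphism ratfun k -> SeqRing} :=
  HB.pack rat_seq
    (GRing.isZmodMorphism.Build (ratfun k) SeqRing rat_seq rat_seq_zmod)
    (GRing.isMonoidMorphism.Build (ratfun k) SeqRing rat_seq rat_seq_monoid).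

Lemma rat_seqS h : rat_seq_rmorphism (dsigma h) = dsigma (rat_seq_rmorphism h).
Proof.
rewrite /= /rat_seq [RHS]seq_sigmaE; apply/seq_classP.
have [N r] := regular_nat k0 h.
exists N => i Ni; rewrite rat_eval_sigma natr1 //.
by apply: r; rewrite leqW.
Qed.

Definition Seq : diffAlg (ratfun k) := @DiffAlg (ratfun k) SeqRing rat_seq_rmorphism rat_seqS.

End Seq.

Section Orbits.
Variables (k : fieldType) (n : nat).

(* The k-points of A^1 x GL_n, inside k x M_n(k). *)
Definition Xpts : set (k * 'M[k]_n) := [set x | x.2 \in unitmx]%classic.

(* A regular function on X, i.e. an element of k[z, Z_ij, 1/det Z], is
   represented by a polynomial in z, the Z_ij and an additional variable
   standing for 1/det Z. *)
Definition regular_fun := {mpoly k[1 + (n * n + 1)]}.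

Definition regular_fun_eval (f : regular_fun) (x : k * 'M[k]_n) : k :=
  let v : 'rV[k]_(1 + (n * n + 1)) :=
    row_mx x.1%:M (row_mx (mxvec x.2) (\det x.2)^-1%:M) in
  f.@[fun i => v 0 i].

Definition closed_subvariety (Y : set (k * 'M[k]_n)) : Prop :=
  exists fs : seq regular_fun,
    Y = [set x | Xpts x /\ forall f, f \in fs -> regular_fun_eval f x = 0]%classic.

Variable A : 'M[ratfun k]_n.

Definition Xsigma (x : k * 'M[k]_n) : k * 'M[k]_n :=
  (x.1 + 1, map_mx (rat_eval^~ x.1) A *m x.2).

(* The largest open subset of X on which sigma is a morphism to X: A must be
   regular at b, and A(b) B must lie in GL_n, i.e. det(A)(b) != 0. *)
Definition Xsigma_dom : set (k * 'M[k]_n) :=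
  [set x | [/\ Xpts x, forall i j, regular_at (A i j) x.1
                & rat_eval (\det A) x.1 != 0]]%classic.

Definition orbit_defined (x : k * 'M[k]_n) : Prop :=
  forall i, Xsigma_dom (iter i Xsigma x).

Definition return_set (x : k * 'M[k]_n) (Y : set (k * 'M[k]_n)) : set nat :=
  [set i | Y (iter i Xsigma x)]%classic.

End Orbits.

Definition arith_prog (j l : nat) : set nat :=
  [set i | exists m, i = (j + m * l)%N]%classic.

Definition finite_union_of_APs (S : set nat) : Prop :=
  exists s : seq (nat * nat),
    S = [set i | exists2 jl, jl \in s & arith_prog jl.1 jl.2 i]%classic.

(* Main.v *)
From HB Require Import structures.
Require Import Defs.
From mathcomp Require Import all_boot all_order all_algebra.
From mathcomp Require Import fraction boolp classical_sets.
From mathcomp Require Import generic_quotient ring_quotient functions mpoly zify ring.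

(* An orbit (m, B_m) of sigma is a fundamental matrix B of sequences, and the
   return set to a hypersurface is the zero set of a polynomial in z, B and
   1/det B, so condition (ii) says that the elements of S = k(z)[B] have
   eventually periodic zero sets.

   If so, let I(c, l) be the ideal of the elements of S vanishing at almost all
   indices congruent to c mod l.  As S is Noetherian, I(0, l) = I(0, t l) for all
   t > 0 and some l; then the I(c, l) are prime, and for the least such l they are
   pairwise incomparable.  Hence nonzerodivisors of S are eventually nonzero, the
   indicator sequences of the residue classes mod l are fractions of elements of
   S, and the total ring of fractions of S is a pseudo field inside Seq.  Its
   constants are constant sequences, i.e. elements of k.

   Conversely, two fundamental matrices in GL_n(Seq) differ by a matrix of
   constants, so a Picard-Vessiot extension L inside Seq contains every orbit
   sequence; and zero sets of elements of a pseudo field inside Seq are periodic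
   because its idempotents are 0-1 sequences permuted cyclically by sigma. *)

Set Implicit Arguments.
Unset Strict Implicit.
Unset Printing Implicit Defensive.

Import Order.LTheory GRing.Theory.
Local Open Scope ring_scope.

(** * Dickson's lemma and chains of polynomial ideals *)

(** Beyond any bound [N] some index minimises [f] over all indices from [N] on; iterating this
    choice gives the subsequence. *)
Lemma nondecreasing_subseq (f : nat -> nat) :
  exists g : nat -> nat, {homo g : i j / (i < j)%N} /\
    {homo (fun i => f (g i)) : i j / (i <= j)%N}.
Proof.
have /choice[m hm] (N : nat) : exists i, (N <= i)%N /\
    forall j, (N <= j)%N -> (f i <= f j)%N.
  have ex : exists v, `[< exists2 i, (N <= i)%N & f i = v >].
    by exists (f N); apply/asboolP; exists N.
  case: (ex_minnP ex) => v /asboolP[i Ni <-] vmin; exists i; split=> // j Nj.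
  by apply: vmin; apply/asboolP; exists j.
pose g i := iter i (fun a => m a.+1) (m 0%N).
have gS i : (g i < g i.+1)%N by rewrite /= (hm _).1.
have glt : {homo g : i j / (i < j)%N} by apply: homo_ltn => //; exact: ltn_trans.
exists g; split=> //; apply: homo_leq => // [|i]; first exact: leq_trans.
case: i => [|i]; apply: (hm _).2 => //.
by rewrite ltnW // (leq_ltn_trans _ (gS i.+1)) //= (hm _).1.
Qed.

Lemma nondecreasing_subseq_finite (u : nat -> nat -> nat) (p : nat) :
  exists g : nat -> nat, {homo g : i j / (i < j)%N} /\
    forall c, (c < p)%N -> {homo (fun i => u (g i) c) : i j / (i <= j)%N}.
Proof.
elim: p => [|p [g [ginc gmono]]]; first by exists id; split=> // c; rewrite ltn0.
have [h [hinc hmono]] := nondecreasing_subseq (fun i => u (g i) p).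
exists (g \o h); split=> [i j ij|c]; first exact: ginc (hinc _ _ ij).
rewrite ltnS leq_eqVlt => /orP[/eqP->//|cp] i j ij.
apply: (gmono c cp); move: ij; rewrite leq_eqVlt => /orP[/eqP->//|/hinc].
exact: ltnW.
Qed.

(** Along a suitable subsequence all exponents are nondecreasing at once, and its first two terms
    already serve. *)
Lemma dickson (m : nat) (u : nat -> 'X_{1..m}) :
  exists i j, (i < j)%N /\ (u i <= u j)%MM.
Proof.
pose v a c := if insub c is Some i then u a i else 0%N.
have [g [ginc gmono]] := nondecreasing_subseq_finite v m.
exists (g 0%N), (g 1%N); split; first exact: ginc.
apply/mnm_lepP => i; have /(_ 0%N 1%N isT) := gmono i (ltn_ord i).
by rewrite /v valK.
Qed.

(* Hilbert's basis theorem in its ascending chain form: by Dickson's lemma the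
   ideals of leading monomials stabilise, and an inclusion of ideals with the
   same leading monomials is an equality. *)
Lemma mpoly_ideal_chain_stable (F : fieldType) (m : nat)
    (I : nat -> {mpoly F[m]} -> Prop) :
  (forall j, I j 0) -> (forall j p q, I j p -> I j q -> I j (p - q)) ->
  (forall j r p, I j p -> I j (r * p)) ->
  (forall i j p, (i <= j)%N -> I i p -> I j p) ->
  exists N, forall j p, (N <= j)%N -> I j p -> I N p.
Proof.
move=> I0 IB IM Imono.
pose LM j mu := exists p, [/\ I j p, p != 0 & mlead p = mu].
have [[N hN]|noN] := pselect (exists N, forall j mu, (N <= j)%N -> LM j mu -> LM N mu).
  (* Induction on the leading monomial: [r] is a multiple of some [q] in [I N] with the leading term
     of [p], so [p - r] is zero or has a smaller leading monomial. *)
  exists N => j p Nj; elim/(@mleadrect m F): p => p IH Ip.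
  have [->//|p0] := eqVneq p 0.
  have [q [Iq q0 qp]] := hN j _ Nj (ex_intro _ p (And3 Ip p0 erefl)).
  have Icq : I N ((mleadc p / mleadc q) *: q) by rewrite -mul_mpolyC; apply: IM.
  set r := (mleadc p / mleadc q) *: q in Icq.
  have Ipr : I j (p - r) by apply: IB => //; exact: Imono Icq.
  suff Ir : I N (p - r).
    by rewrite -(subrK r p) -[X in _ + X]opprK; apply: (IB) => //; rewrite -(sub0r r); apply: IB.
  have [->//|pr0] := eqVneq (p - r) 0.
  apply: IH => //; rewrite lt_neqAle; apply/andP; split.
    apply: contraNneq pr0 => E; rewrite -mleadc_eq0 E mcoeffB mcoeffZ -qp divfK ?subrr //.
    by rewrite mleadc_eq0.
  apply: Order.POrderTheory.le_trans (mleadB_le _ _) _.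
  by rewrite leUx lexx -qp mleadZ_le.
(* Otherwise each stage [N] misses a leading monomial [(s N).2] of some later stage [(s N).1]; [t]
   iterates the passage to that stage. *)
have /choice[s hs] (N : nat) : exists jmu : nat * 'X_{1..m},
    [/\ (N <= jmu.1)%N, LM jmu.1 jmu.2 & ~ LM N jmu.2].
  apply: contrapT => no; apply: noN; exists N => j mu Nj Lj.
  by apply: contrapT => LN; apply: no; exists (j, mu).
pose t i := iter i (fun a => (s a).1) 0%N.
have tmono : {homo t : i j / (i <= j)%N}.
  apply: homo_leq => [||i]; [exact: leqnn|exact: leq_trans|by case: (hs (t i))].
have [a [b [ab]]] := dickson (fun i => (s (t i)).2).
have [_ [p [Ip p0 pa]] _] := hs (t a); have [_ _ nLb] := hs (t b).
(* The monomial of [t a] divides that of [t b], so a monomial multiple of [p], already in [I (t b)],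
   has the leading monomial chosen to be missing there. *)
move=> /submK ba; case: nLb; exists ('X_[(s (t b)).2 - (s (t a)).2] * p); split.
- by apply: IM; apply: Imono Ip; apply: (tmono a.+1).
- by rewrite mulf_neq0 // -mleadc_eq0 mleadXm mcoeffX eqxx oner_eq0.
- by rewrite mleadM ?mleadXm ?pa // -mleadc_eq0 mleadXm mcoeffX eqxx oner_eq0.
Qed.

(** * Eventually periodic sets of indices *)

Definition eventually_all (P : nat -> Prop) : Prop :=
  exists N, forall i, (N <= i)%N -> P i.

Lemma eventually_allW (P Q : nat -> Prop) :
  (forall i, P i -> Q i) -> eventually_all P -> eventually_all Q.
Proof. by move=> PQ [N hN]; exists N => i /hN /PQ. Qed.

Lemma eventually_all2 (P Q T : nat -> Prop) :
  eventually_all P -> eventually_all Q -> (forall i, P i -> Q i -> T i) ->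
  eventually_all T.
Proof.
move=> [N1 h1] [N2 h2] h; exists (maxn N1 N2) => i.
by rewrite geq_max => /andP[/h1 ? /h2 ?]; apply: h.
Qed.

Lemma eventually_all_and (P Q : nat -> Prop) :
  eventually_all P -> eventually_all Q -> eventually_all (fun i => P i /\ Q i).
Proof. by move=> hP hQ; exact: eventually_all2 hP hQ (fun i => @conj _ _). Qed.

Lemma eventually_all_fin (I : finType) (P : I -> nat -> Prop) :
  (forall a, eventually_all (P a)) -> eventually_all (fun i => forall a, P a i).
Proof.
move=> /choice[N hN]; exists (\max_a N a) => i Ni a; apply: hN.
exact: leq_trans (leq_bigmax a) Ni.
Qed.

Lemma eventually_allS (P : nat -> Prop) :
  eventually_all P -> eventually_all (fun i => P i.+1).
Proof. by case=> N hN; exists N => i Ni; apply: hN; rewrite leqW. Qed.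

Definition eventually_periodic (S : set nat) : Prop :=
  exists2 l, (0 < l)%N & eventually_all (fun i => S (i + l)%N <-> S i).

Lemma eventually_periodicM (S : set nat) (N l t i : nat) :
  (forall i, (N <= i)%N -> (S (i + l)%N <-> S i)) -> (N <= i)%N ->
  S (i + t * l)%N <-> S i.
Proof.
move=> hN Ni; elim: t => [|t IH]; first by rewrite addn0.
by rewrite mulSn addnCA addnC hN // (leq_trans Ni) // leq_addr.
Qed.

Lemma eventually_periodic_ext (S T : set nat) :
  eventually_all (fun i => S i <-> T i) ->
  eventually_periodic S -> eventually_periodic T.
Proof.
move=> [N1 h1] [l l0 [N2 h2]]; exists l => //; exists (maxn N1 N2) => i.
rewrite geq_max => /andP[N1i N2i].
by rewrite -h1 ?(leq_trans N1i) ?leq_addr // -h1 //; apply: h2.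
Qed.

(** Both sets repeat after the product of the two periods, whatever the connective [F]. *)
Lemma eventually_periodic2 (F : Prop -> Prop -> Prop) (S T : set nat) :
  eventually_periodic S -> eventually_periodic T ->
  eventually_periodic (fun i => F (S i) (T i)).
Proof.
move=> [l l0 [N1 h1]] [p p0 [N2 h2]]; exists (l * p)%N; first by rewrite muln_gt0 l0.
exists (maxn N1 N2) => i; rewrite geq_max => /andP[N1i N2i].
have -> : S (i + l * p)%N = S i.
  by apply/propext; rewrite mulnC; apply: eventually_periodicM h1 N1i.
by have -> : T (i + l * p)%N = T i by apply/propext; apply: eventually_periodicM h2 N2i.
Qed.

Lemma eventually_periodic_cst (P : Prop) : eventually_periodic (fun=> P).
Proof. by exists 1%N => //; exists 0%N. Qed.

Lemma eventually_periodic_AP (j l : nat) : eventually_periodic (arith_prog j l).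
Proof.
case: l => [|l].
  apply: eventually_periodic_ext (eventually_periodic_cst False).
  by exists j.+1 => i ji; split=> // -[m]; lia.
exists l.+1 => //; exists j => i ji; split=> -[m E].
  case: m E => [|m] E; first by lia.
  by exists m; lia.
by exists m.+1; lia.
Qed.

Lemma finite_union_of_APsP (S : set nat) :
  finite_union_of_APs S <-> eventually_periodic S.
Proof.
split=> [[s ->]|[l l0 [N hN]]].
  elim: s => [|[j l] s IH].
    apply: eventually_periodic_ext (eventually_periodic_cst False).
    by exists 0%N => i _; split=> // -[].
  apply: eventually_periodic_ext (eventually_periodic2 or (eventually_periodic_AP j l) IH).
  exists 0%N => i _; split=> [[ijl|[jl js ijl]]|[jl]].
  - by exists (j, l) => //; rewrite mem_head.
  - by exists jl => //; rewrite inE js orbT.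
  - by rewrite inE => /orP[/eqP->|js] ijl; [left|right; exists jl].
(* Singletons, of difference 0, cover the members below [N]; each member in the window of length [l]
   from [N] on starts a progression of difference [l]. *)
pose s0 := [seq (i, 0%N) | i <- iota 0 N & `[< S i >]].
pose s1 := [seq (i, l) | i <- iota N l & `[< S i >]].
exists (s0 ++ s1); apply/seteqP; split=> i /=.
  move=> Si; have [iN|Ni] := ltnP i N.
    exists (i, 0%N); last by exists 0%N; rewrite /= addn0.
    rewrite mem_cat; apply/orP; left; apply/mapP; exists i => //.
    by rewrite mem_filter mem_iota iN /= andbT; apply/asboolP.
  have E : i = (N + (i - N) %% l + (i - N) %/ l * l)%N by have := divn_eq (i - N) l; lia.
  exists ((N + (i - N) %% l)%N, l); last by exists ((i - N) %/ l)%N.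
  rewrite mem_cat; apply/orP; right; apply/mapP; exists (N + (i - N) %% l)%N => //.
  rewrite mem_filter mem_iota leq_addr ltn_add2l ltn_mod l0 !andbT; apply/asboolP.
  by move: Si; rewrite {1}E; apply: (eventually_periodicM _ hN _).1; exact: leq_addr.
move=> [jl]; rewrite mem_cat => /orP[] /mapP[j]; rewrite mem_filter => /andP[/asboolP Sj].
  by rewrite mem_iota => _ -> [m] /= ->; rewrite muln0 addn0.
rewrite mem_iota => /andP[Nj _] -> [m /= ->].
exact: (eventually_periodicM _ hN Nj).2.
Qed.

(** * Sequences up to eventual equality, computed on representatives *)

Section SeqTheory.
Variable k : fieldType.
Implicit Types (s t : SeqRing k) (f : nat -> k).

HB.instance Definition _ :=
  GRing.isZmodMorphism.Build (nat -> k) (SeqRing k) (@seq_class k) (@seq_classB k).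
HB.instance Definition _ :=
  GRing.isMonoidMorphism.Build (nat -> k) (SeqRing k) (@seq_class k)
    (conj (@seq_class1 k) (@seq_classM k)).

Lemma seq_repr_class f : eventually_all (fun i => seq_repr (seq_class f) i = f i).
Proof. by apply/seq_classP; rewrite seq_reprK. Qed.

Lemma seq_eqP s t : s = t <-> eventually_all (fun i => seq_repr s i = seq_repr t i).
Proof. by rewrite -{1}(seq_reprK s) -{1}(seq_reprK t); exact: seq_classP. Qed.

Lemma seq_reprB s t :
  eventually_all (fun i => seq_repr (s - t) i = seq_repr s i - seq_repr t i).
Proof.
by rewrite -{1}(seq_reprK s) -{1}(seq_reprK t) -raddfB; exact: seq_repr_class.
Qed.

Lemma seq_reprD s t :
  eventually_all (fun i => seq_repr (s + t) i = seq_repr s i + seq_repr t i).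
Proof.
by rewrite -{1}(seq_reprK s) -{1}(seq_reprK t) -raddfD; exact: seq_repr_class.
Qed.

Lemma seq_reprM s t :
  eventually_all (fun i => seq_repr (s * t) i = seq_repr s i * seq_repr t i).
Proof.
by rewrite -{1}(seq_reprK s) -{1}(seq_reprK t) -rmorphM; exact: seq_repr_class.
Qed.

Lemma seq_repr0 : eventually_all (fun i => seq_repr (0 : SeqRing k) i = 0).
Proof. by rewrite -(raddf0 (@seq_class k)); exact: seq_repr_class. Qed.

Lemma seq_repr1 : eventually_all (fun i => seq_repr (1 : SeqRing k) i = 1).
Proof. by rewrite -(rmorph1 (@seq_class k)); exact: seq_repr_class. Qed.

Lemma seq_repr_sigma s : eventually_all (fun i => seq_repr (dsigma s) i = seq_repr s i.+1).
Proof. exact: seq_repr_class. Qed.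

Lemma seq_repr_sum (I : finType) (F : I -> SeqRing k) :
  eventually_all (fun i => seq_repr (\sum_a F a) i = \sum_a seq_repr (F a) i).
Proof.
have -> : \sum_a F a = seq_class (\sum_a seq_repr (F a)).
  by rewrite raddf_sum; apply: eq_bigr => a _; rewrite /= seq_reprK.
have := seq_repr_class (\sum_a seq_repr (F a)); apply: eventually_allW => i ->.
by rewrite fct_sumE.
Qed.

Definition seq_nonvanishing s := eventually_all (fun i => seq_repr s i != 0).

Lemma seq_nonvanishingP s : seq_nonvanishing s <-> exists t, s * t = 1.
Proof.
split=> [s0|[t st]].
  exists (seq_class (fun i => (seq_repr s i)^-1)).
  rewrite -{1}(seq_reprK s) -seq_classM -seq_class1; apply/seq_classP.
  by case: s0 => N hN; exists N => i /hN; apply: divff.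
have [N hN] : eventually_all (fun i => seq_repr s i * seq_repr t i = 1).
  by apply: eventually_all2 (seq_reprM s t) seq_repr1 _ => i <-; rewrite st.
exists N => i /hN st1; apply: contra_eq_neq st1 => ->.
by rewrite mul0r eq_sym oner_neq0.
Qed.

End SeqTheory.

(** * Ideals of sequences vanishing on a residue class *)

Section Vanishing.
Variable k : fieldType.
Implicit Types (s t : SeqRing k).

(** The ideal [I(c, l)], taken in all of [SeqRing k] instead of [S]. *)
Definition vanishes_on (c l : nat) s : Prop :=
  eventually_all (fun i => i = c %[mod l] -> seq_repr s i = 0).

Lemma vanishes_on0 c l : vanishes_on c l 0.
Proof. by apply: eventually_allW (@seq_repr0 k) => i ->. Qed.

Lemma vanishes_onB c l s t :
  vanishes_on c l s -> vanishes_on c l t -> vanishes_on c l (s - t).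
Proof.
move=> hs ht; apply: eventually_all2 (eventually_all_and hs ht) (seq_reprB s t) _.
by move=> i [si ti] -> ic; rewrite si // ti // subrr.
Qed.

Lemma vanishes_onM c l s t : vanishes_on c l s -> vanishes_on c l (t * s).
Proof.
move=> hs; apply: eventually_all2 hs (seq_reprM t s) _.
by move=> i si -> ic; rewrite si // mulr0.
Qed.

Lemma vanishes_on_sigma c l s : vanishes_on c l (dsigma s) <-> vanishes_on c.+1 l s.
Proof.
have sE := seq_repr_sigma s; split=> hs.
  have [N hN] : eventually_all (fun i => i = c %[mod l] -> seq_repr s i.+1 = 0).
    by apply: eventually_all2 hs sE _ => i si <-.
  (* The bound [N.+1] excludes the index 0, which is no successor. *)
  exists N.+1 => -[//|i]; rewrite ltnS => Ni ic; apply: hN => //.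
  by apply/eqP; rewrite -(eqn_modDr 1) !addn1; apply/eqP.
apply: eventually_all2 (eventually_allS hs) sE _ => i si -> ic; apply: si.
by apply/eqP; rewrite -addn1 -(addn1 c) eqn_modDr; apply/eqP.
Qed.

Lemma vanishes_on_iter_sigma c l e s :
  vanishes_on c l (iter e dsigma s) <-> vanishes_on (c + e) l s.
Proof.
elim: e s => [|e IH] s; first by rewrite addn0.
by rewrite iterSr IH vanishes_on_sigma addnS.
Qed.

Lemma vanishes_on_mod c c' l s :
  c = c' %[mod l] -> vanishes_on c l s -> vanishes_on c' l s.
Proof. by move=> cc'; apply: eventually_allW => i si ic; apply: si; rewrite cc'. Qed.

Lemma vanishes_on_sub c c' l l' s : (l %| l')%N -> c = c' %[mod l] ->
  vanishes_on c l s -> vanishes_on c' l' s.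
Proof.
move=> ll' cc'; apply: eventually_allW => i si ic; apply: si.
by rewrite cc' -(modn_dvdm i ll') ic modn_dvdm.
Qed.

End Vanishing.

(** * Stable periods and primality of the vanishing ideals *)

Section PeriodicZeros.
Variables (k : fieldType) (S : SeqRing k -> Prop).
Hypothesis S1 : S 1.
Hypothesis SM : forall s t, S s -> S t -> S (s * t).
Hypothesis Ssigma : forall s, S s -> S (dsigma s).
Hypothesis Sper : forall s, S s -> eventually_periodic (fun i => seq_repr s i = 0).
Implicit Types (s t : SeqRing k).

(** At such an [l] the ideals [I(0, m * l)] of [S] no longer grow. Only the class of 0 is mentioned,
    since [dsigma] transports the property to the other classes. *)
Definition stable_period (l : nat) : Prop :=
  (0 < l)%N /\
  forall m s, (0 < m)%N -> S s -> vanishes_on 0 (m * l) s -> vanishes_on 0 l s.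

Lemma stable_period_shift l c m s : stable_period l -> (0 < m)%N -> S s ->
  vanishes_on c (m * l) s -> vanishes_on c l s.
Proof.
move=> [_ st] m0; elim: c s => [|c IH] s Ss; first exact: st.
by rewrite -!vanishes_on_sigma; apply: IH; apply: Ssigma.
Qed.

Lemma zero_vanishes_on s : S s -> exists p N, (0 < p)%N /\
  forall i, (N <= i)%N -> seq_repr s i = 0 -> vanishes_on i p s.
Proof.
move=> /Sper[p p0 [N hN]]; exists p, N; split=> // i Ni si; exists i => j ij /eqP.
rewrite eqn_mod_dvd // => /dvdnP[m jE].
have -> : j = (i + m * p)%N by lia.
exact: (eventually_periodicM _ hN Ni).2.
Qed.

(** At one late index of the class a factor is zero, as [k] is a field; periodicity of its zeros
    makes it vanish on a smaller class, and stability of [l] spreads this over the whole class. *)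
Lemma vanishes_on_prime l c s t : stable_period l -> S s -> S t ->
  vanishes_on c l (s * t) -> vanishes_on c l s \/ vanishes_on c l t.
Proof.
move=> st Ss St hst; have [l0 _] := st.
have [p [N1 [p0 h1]]] := zero_vanishes_on Ss.
have [q [N2 [q0 h2]]] := zero_vanishes_on St.
have [N hN] : eventually_all (fun i => i = c %[mod l] ->
    seq_repr s i = 0 \/ seq_repr t i = 0).
  apply: eventually_all2 hst (seq_reprM s t) _ => i sti sE ic; move: (sti ic).
  by rewrite sE => /eqP; rewrite mulf_eq0 => /orP[] /eqP; [left|right].
pose i := (c + l * (N + N1 + N2))%N.
have ic : i = c %[mod l] by rewrite /i addnC mulnC modnMDl.
have iN : (N <= i /\ N1 <= i /\ N2 <= i)%N by rewrite /i; split; last split; nia.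
have big s' r : S s' -> (0 < r)%N -> vanishes_on i r s' -> vanishes_on c l s'.
  move=> Ss' r0 h; apply: vanishes_on_mod ic _.
  apply: (stable_period_shift st r0 Ss').
  by apply: vanishes_on_sub h => //; exact: dvdn_mulr.
by have [si|ti] := hN i iN.1 ic; [left; apply: big (h1 _ _ si)|right; apply: big (h2 _ _ ti)]; tauto.
Qed.

(** By the same spreading argument, a single late zero in the class would force vanishing on all of
    it. *)
Lemma nonvanishing_on_class l c s : stable_period l -> S s -> ~ vanishes_on c l s ->
  eventually_all (fun i => i = c %[mod l] -> seq_repr s i != 0).
Proof.
move=> st Ss ncs; have [p [N [p0 hN]]] := zero_vanishes_on Ss.
exists N => i Ni ic; apply/eqP => si; apply: ncs; apply: vanishes_on_mod ic _.
apply: (stable_period_shift st p0 Ss).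
by apply: vanishes_on_sub (hN i Ni si) => //; exact: dvdn_mulr.
Qed.

Lemma nonvanishing_of_classes l s : stable_period l -> S s ->
  (forall c, ~ vanishes_on c l s) -> seq_nonvanishing s.
Proof.
move=> st Ss hs; have [l0 _] := st.
have [N hN] : eventually_all (fun i => forall c : 'I_l, i = c %[mod l] -> seq_repr s i != 0).
  by apply: eventually_all_fin => c; exact: nonvanishing_on_class.
exists N => i Ni; apply: (hN i Ni (Ordinal (ltn_pmod i l0))).
by rewrite /= modn_mod.
Qed.

Variable l : nat.
Hypothesis stable_l : stable_period l.
Hypothesis min_l : forall g, stable_period g -> (l <= g)%N.

(* If the ideal of the class [c'] were contained in that of [c], then moving both
   along by [dsigma] would make [gcdn (c - c') l] a stable period smaller than
   [l]. *)
Lemma vanishing_ideals_incomparable c c' : c <> c' %[mod l] ->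
  exists s, [/\ S s, vanishes_on c' l s & ~ vanishes_on c l s].
Proof.
have l0 := stable_l.1; move=> cc'; apply: contrapT => no.
(* Applying the inclusion to iterates of [dsigma] translates both classes by [e]. *)
have incl e s : S s -> vanishes_on (c' + e) l s -> vanishes_on (c + e) l s.
  move=> Ss; rewrite -!vanishes_on_iter_sigma => hs; apply: contrapT => nhs.
  by apply: no; exists (iter e dsigma s); split=> //; elim: e {hs nhs} => //= e; apply: Ssigma.
(* Modulo [l], [x] represents [- c'] and [d] below represents [c - c']. *)
pose x := (l - c' %% l)%N.
have c'x b : b + (c' + x) = b %[mod l].
  by rewrite -modnDmr -(modnDml c') /x subnKC ?modnn ?addn0 // ltnW // ltn_mod.
pose d := (c + x)%N; pose g := gcdn d l.
have step j a s : S s -> vanishes_on a l s -> vanishes_on (a + j * d) l s.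
  move=> Ss; elim: j => [|j IH]; first by rewrite addn0.
  move=> /IH h; have := incl (a + j * d + x)%N s Ss.
  have -> : (c + (a + j * d + x) = a + j.+1 * d)%N by rewrite mulSn /d; lia.
  by apply; apply: vanishes_on_mod h; rewrite addnCA c'x.
have g0 : (0 < g)%N by rewrite gcdn_gt0 l0 orbT.
have [a _ /dvdnP[b ab]] := Bezoutr d l0.
have vg s : S s -> vanishes_on 0 l s -> vanishes_on 0 g s.
  move=> Ss hs.
  have [N hN] : eventually_all (fun i => forall r : 'I_l, (g %| r)%N ->
      i = r %[mod l] -> seq_repr s i = 0).
    apply: eventually_all_fin => r.
    have [/dvdnP[m rE]|_] := boolP (g %| r)%N; last by exists 0%N.
    (* By Bezout [g] is congruent to [- a * d], so [r = m * g] is reached from 0 in [m * a * l.-1]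
       steps of length [d], with [l.-1] standing for -1 modulo [l]. *)
    apply: eventually_allW (step (m * a * l.-1)%N 0%N s Ss hs) => i si _ ir; apply: si.
    rewrite ir; apply/eqP; rewrite -(eqn_modDr (m * a * d)).
    have -> : (r + m * a * d = m * b * l)%N by rewrite rE /g; nia.
    have -> : (0 + m * a * l.-1 * d + m * a * d = m * a * d * l)%N.
      by rewrite add0n -[in RHS](prednK l0); ring.
    by rewrite !modnMl.
  exists N => i Ni ig; have /(_ (Ordinal (ltn_pmod i l0)))/= := hN i Ni.
  apply; last by rewrite modn_mod.
  by rewrite /dvdn (modn_dvdm _ (dvdn_gcdr d l)) ig mod0n.
have stg : stable_period g.
  split=> // m s m0 Ss hs; apply: vg => //; apply: (stable_l.2 (m * g)%N) => //.
    by rewrite muln_gt0 m0.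
  by apply: vanishes_on_sub hs => //; exact: dvdn_mulr.
(* Minimality makes [l] divide [d], so the two classes coincide. *)
have lg : l = g by apply/eqP; rewrite eqn_leq min_l //= dvdn_leq // dvdn_gcdr.
apply: cc'; rewrite -(c'x c) addnCA -/d.
have /dvdnP[q ->] : (l %| d)%N by rewrite lg dvdn_gcdl.
by rewrite addnC modnMDl.
Qed.

(** Multiply, over the classes other than that of [c], elements vanishing there but not on [c];
    primality of the ideal of [c] keeps the product outside it. *)
Lemma isolating_element c :
  exists g, [/\ S g, ~ vanishes_on c l g &
    forall c', c' <> c %[mod l] -> vanishes_on c' l g].
Proof.
have l0 := stable_l.1.
suff /(_ [seq a <- iota 0 l | a != c %% l]%N)[|g [Sg ncg hg]] : forall cs : seq nat,
    (forall a, a \in cs -> c <> a %[mod l]) ->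
    exists g, [/\ S g, ~ vanishes_on c l g & forall a, a \in cs -> vanishes_on a l g].
- move=> a; rewrite mem_filter mem_iota add0n => /and3P[/eqP ac _ al] E.
  by case: ac; rewrite E modn_small.
- exists g; split=> // c' c'c; apply: (@vanishes_on_mod _ (c' %% l)); first by rewrite modn_mod.
  by apply: hg; rewrite mem_filter mem_iota add0n ltn_mod l0 !andbT; apply/eqP.
elim=> [_|a cs IH hcs].
  exists 1; split=> // [] [N hN]; have [M hM] := seq_repr1 k.
  pose i := (c + (N + M) * l)%N; have iN : (N <= i)%N by rewrite /i; nia.
  have iM : (M <= i)%N by rewrite /i; nia.
  have := hN i iN; rewrite (hM i iM) /i addnC modnMDl => /(_ erefl)/eqP.
  by rewrite oner_eq0.
have [|g [Sg ncg hg]] := IH; first by move=> b bcs; apply: hcs; rewrite inE bcs orbT.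
have [h [Sh ha nch]] := vanishing_ideals_incomparable (hcs a (mem_head _ _)).
exists (g * h); split; first exact: SM.
  by move=> /(vanishes_on_prime stable_l Sg Sh)[].
move=> b; rewrite inE => /orP[/eqP->|/hg bg]; first exact: vanishes_onM.
by rewrite mulrC; apply: vanishes_onM.
Qed.

End PeriodicZeros.

(** * Rings of fractions inside the ring of sequences *)

Section SubDiffAlgVal.
Variables (K : diffFieldType) (M : diffAlg K) (L : subDiffAlg M).

Definition sda_incl (x : L) : M := sda_val x.

Lemma sda_incl_zmod : zmod_morphism sda_incl.
Proof. by []. Qed.

Lemma sda_incl_monoid : monoid_morphism sda_incl.
Proof. by []. Qed.

HB.instance Definition _ := GRing.isZmodMorphism.Build L M sda_incl sda_incl_zmod.
HB.instance Definition _ := GRing.isMonoidMorphism.Build L M sda_incl sda_incl_monoid.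

Lemma sda_incl_inj : injective sda_incl.
Proof. exact: val_inj. Qed.

End SubDiffAlgVal.

Section Fractions.
Variables (k : fieldType) (k0 : [pchar k] =i pred0) (S : SeqRing k -> Prop).
Hypothesis Smap : forall h, S (rat_seq h).
Hypothesis SB : forall s t, S s -> S t -> S (s - t).
Hypothesis SM : forall s t, S s -> S t -> S (s * t).
Hypothesis Ssigma : forall s, S s -> S (dsigma s).
Implicit Types (s t x : SeqRing k).

(** Denominators are required to be units of [SeqRing k]; by [fraction_nonzerodivisor] this will
    allow all nonzerodivisors of [S]. *)
Definition seq_fractions : {pred SeqRing k} :=
  fun x => `[< exists r s, [/\ S r, S s, seq_nonvanishing s & x * s = r] >].

Lemma seq_nonvanishingM s t :
  seq_nonvanishing s -> seq_nonvanishing t -> seq_nonvanishing (s * t).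
Proof.
move=> /seq_nonvanishingP[s' ss'] /seq_nonvanishingP[t' tt'].
by apply/seq_nonvanishingP; exists (s' * t'); rewrite mulrACA ss' tt' mulr1.
Qed.

Lemma seq_nonvanishing_reg s x : seq_nonvanishing s -> x * s = 0 -> x = 0.
Proof.
by move=> /seq_nonvanishingP[t st] xs; rewrite -[x]mulr1 -st mulrA xs mul0r.
Qed.

Lemma fractions1S : S 1.
Proof. by have := Smap 1; rewrite -[rat_seq 1]/(rat_seq_rmorphism k0 1) rmorph1. Qed.

Lemma fractions0S : S 0.
Proof. by rewrite -(subrr 1); apply: SB; exact: fractions1S. Qed.

Lemma fractionsDS s t : S s -> S t -> S (s + t).
Proof.
move=> Ss St; rewrite -[t]opprK -[- t]sub0r; apply: SB => //.
by apply: SB => //; exact: fractions0S.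
Qed.

Lemma seq_nonvanishing1 : seq_nonvanishing (1 : SeqRing k).
Proof. by apply/seq_nonvanishingP; exists 1; rewrite mulr1. Qed.

Lemma seq_fractions_sub s : S s -> s \in seq_fractions.
Proof.
move=> Ss; apply/asboolP; exists s, 1; split=> //; [exact: fractions1S|exact: seq_nonvanishing1|].
by rewrite mulr1.
Qed.

Lemma seq_fractions_inv s t : S s -> s * t = 1 -> t \in seq_fractions.
Proof.
move=> Ss st; apply/asboolP; exists 1, s; split=> //; first exact: fractions1S.
  by apply/seq_nonvanishingP; exists t.
by rewrite mulrC.
Qed.

Lemma seq_fractions_subring : subring_closed seq_fractions.
Proof.
split=> [|x y /asboolP[r [s [Sr Ss s0 xs]]] /asboolP[r' [s' [Sr' Ss' s0' ys]]]|
  x y /asboolP[r [s [Sr Ss s0 xs]]] /asboolP[r' [s' [Sr' Ss' s0' ys]]]].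
- exact: seq_fractions_sub fractions1S.
- apply/asboolP; exists (r * s' - r' * s), (s * s'); split.
  + by apply: SB; apply: SM.
  + exact: SM.
  + exact: seq_nonvanishingM.
  + by rewrite -xs -ys; ring.
- apply/asboolP; exists (r * r'), (s * s'); split; [exact: SM|exact: SM| |].
  + exact: seq_nonvanishingM.
  + by rewrite -xs -ys; ring.
Qed.

Lemma seq_fractions_sigma x : x \in seq_fractions -> dsigma x \in seq_fractions.
Proof.
move=> /asboolP[r [s [Sr Ss s0 xs]]]; apply/asboolP.
exists (dsigma r), (dsigma s); split; [exact: Ssigma|exact: Ssigma| |].
  have /seq_nonvanishingP[t st] := s0; apply/seq_nonvanishingP.
  by exists (dsigma t); rewrite -rmorphM st rmorph1.
by rewrite -rmorphM xs.
Qed.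

Definition fraction_subalg : subDiffAlg (Seq k0) :=
  @SubDiffAlg _ (Seq k0) seq_fractions seq_fractions_subring
    (fun h => seq_fractions_sub (Smap h)) seq_fractions_sigma.

(** Multiplication by [e i] extracts the component of index [i], which gives both existence and
    uniqueness of the decomposition. *)
Lemma pseudo_field_of_idempotents (L : diffRingType) (l : nat) (e : 'I_l -> L) :
  (forall i, e i * e i = e i) -> (forall i j, i != j -> e i * e j = 0) ->
  \sum_i e i = 1 -> (forall i, dsigma (e i) = e (ordS i)) ->
  (forall i, ideal_is_field (e i)) -> pseudo_field L.
Proof.
move=> eid eorth esum esigma efield; exists l, e; split=> // x.
exists [ffun i => e i * x]; split=> [|f [ef ->]].
  split=> [i|]; first by rewrite ffunE; exists x.
  by under eq_bigr do rewrite ffunE; rewrite -mulr_suml esum mul1r.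
apply/ffunP => i; rewrite ffunE mulr_sumr (bigD1 i) //= big1 => [|j ji].
  by have [y ->] := ef i; rewrite mulrA eid addr0.
by have [y ->] := ef j; rewrite mulrA eorth 1?eq_sym // mul0r.
Qed.

Hypothesis Sper : forall s, S s -> eventually_periodic (fun i => seq_repr s i = 0).
Variable l : nat.
Hypothesis stable_l : stable_period S l.
Hypothesis min_l : forall g, stable_period S g -> (l <= g)%N.

(** The support is the class of [- i]; with this sign the shift [dsigma] sends [i] to [ordS i]. *)
Definition class_indicator (i : nat) : SeqRing k :=
  seq_class (fun m => (l %| m + i)%N%:R).

Lemma class_indicatorM i s : eventually_all (fun m =>
  seq_repr (class_indicator i * s) m = (l %| m + i)%N%:R * seq_repr s m).
Proof.
have hE := seq_repr_class (fun m => (l %| m + i)%N%:R : k).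
by apply: eventually_all2 (seq_reprM (class_indicator i) s) hE _ => m -> ->.
Qed.

Lemma ord_dvdn_inj m (i j : 'I_l) : (l %| m + i)%N -> (l %| m + j)%N -> i = j.
Proof.
move=> /eqP mi /eqP mj; apply/val_inj; rewrite /= -(modn_small (ltn_ord i)).
by rewrite -[RHS](modn_small (ltn_ord j)); apply/eqP; rewrite -(eqn_modDl m) mi mj.
Qed.

Lemma ord_dvdn_surj m : exists i : 'I_l, (l %| m + i)%N.
Proof.
have l0 := stable_l.1.
exists (Ordinal (ltn_pmod (l - m %% l) l0)); rewrite /= /dvdn modnDmr -modnDml.
by rewrite subnKC ?modnn // ltnW // ltn_mod.
Qed.

Lemma class_indicatorM_eq0 (i c : nat) s : (l %| c + i)%N -> vanishes_on c l s ->
  class_indicator i * s = 0.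
Proof.
move=> ci cs; apply/seq_eqP.
apply: eventually_all2 (eventually_all_and cs (seq_repr0 k)) (class_indicatorM i s) _.
move=> m [sm ->] ->; case: dvdnP => [/dvdnP mi|_]; last by rewrite mul0r.
rewrite sm ?mulr0 //; apply/eqP; rewrite -(eqn_modDr i).
by rewrite (eqP mi) (eqP ci).
Qed.

Lemma class_indicator_idem i : class_indicator i * class_indicator i = class_indicator i.
Proof.
rewrite -seq_classM; apply/seq_classP; exists 0%N => m _ /=.
by rewrite -[LHS]natrM mulnb andbb.
Qed.

Lemma class_indicator_orth (i j : 'I_l) : i != j ->
  class_indicator i * class_indicator j = 0.
Proof.
move=> ij; rewrite -seq_classM -(raddf0 (@seq_class k)); apply/seq_classP.
exists 0%N => m _; rewrite -[LHS]natrM mulnb; case: andP => // -[mi mj].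
by case/eqP: ij; exact: ord_dvdn_inj mi mj.
Qed.

Lemma class_indicator_sigma (i : 'I_l) :
  dsigma (class_indicator i) = class_indicator (ordS i).
Proof.
rewrite [LHS]seq_sigmaE; congr seq_class; apply/funext => m /=.
by rewrite /dvdn modnDmr addSnnS.
Qed.

(* [g i] is supported on the indices congruent to [- i] modulo [l]. *)
Lemma isolating_family : exists g : 'I_l -> SeqRing k,
  [/\ forall i, S (g i),
      forall i c, vanishes_on c l (g i) -> ~~ (l %| c + i)%N,
      seq_nonvanishing (\sum_i g i) &
      forall i : 'I_l, class_indicator i * \sum_i g i = g i].
Proof.
have l0 := stable_l.1.
have /choice[g hg] (i : 'I_l) := isolating_element fractions1S SM Ssigma Sper stable_l min_l (l - i)%N.
have classE (i : 'I_l) c : (l %| c + i)%N = (c == l - i %[mod l])%N.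
  by rewrite -(eqn_modDr i) subnK ?modnn // ltnW.
have Sg i : S (g i) by case: (hg i).
have supp : eventually_all (fun m => forall i : 'I_l, ~~ (l %| m + i)%N -> seq_repr (g i) m = 0).
  apply: eventually_all_fin => i; have [_ _ gi] := hg i.
  have [N hN] : eventually_all (fun m => forall c : 'I_l, ~~ (l %| c + i)%N ->
      m = c %[mod l] -> seq_repr (g i) m = 0).
    apply: eventually_all_fin => c; have [|ci] := boolP (l %| c + i)%N; first by exists 0%N.
    by apply: eventually_allW (gi c _) => [m hm _ //|]; apply/eqP; rewrite -classE.
  exists N => m Nm; rewrite classE => mi.
  apply: (hN m Nm (Ordinal (ltn_pmod m l0))); last by rewrite /= modn_mod.
  by rewrite /= classE modn_mod.
have suppE (i : 'I_l) c : vanishes_on c l (g i) -> ~~ (l %| c + i)%N.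
  rewrite classE => gc; apply/eqP => ci; have [_ gi _] := hg i; apply: gi.
  exact: vanishes_on_mod gc.
have inj m (i a : 'I_l) : (l %| m + i)%N -> a != i -> ~~ (l %| m + a)%N.
  by move=> mi; apply: contra => ma; rewrite (ord_dvdn_inj ma mi).
(* The supports are disjoint, so on the class of [- i] the sum is [g i]. *)
have sumE : eventually_all (fun m => forall i : 'I_l, (l %| m + i)%N ->
    seq_repr (\sum_a g a) m = seq_repr (g i) m).
  apply: eventually_all2 supp (seq_repr_sum g) _ => m sm -> i mi.
  by rewrite (bigD1 i) //= big1 ?addr0 // => a ai; apply: sm; apply: inj ai.
have Ssum : S (\sum_i g i).
  by elim/big_ind : _ => //; [exact: fractions0S|exact: fractionsDS].
exists g; split=> //.
  apply: (nonvanishing_of_classes Ssigma Sper stable_l Ssum) => c hc.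
  have [i ci] := ord_dvdn_surj c; move: (ci); apply/negP; apply: suppE.
  apply: eventually_all2 hc sumE _ => m h1 h2 mc; rewrite -h2 ?h1 //.
  by rewrite /dvdn -modnDml mc modnDml.
move=> i; apply/seq_eqP.
apply: eventually_all2 (eventually_all_and supp sumE) (class_indicatorM i (\sum_a g a)) _.
move=> m [h1 h2] ->; have [mi|mi] := boolP (l %| m + i)%N.
  by rewrite mul1r (h2 i mi).
by rewrite mul0r (h1 i mi).
Qed.

(** The indicators are the fractions [g i / h]. If [x = r / s] and [e i * x] is nonzero, then [r] is
    eventually nonzero on the class of [- i], and replacing [r] by 1 off this class gives a unit
    from which the inverse in [e i L] is built. *)
Lemma fraction_pseudo_field : pseudo_field fraction_subalg.
Proof.
have [g [Sg suppg h0 gE]] := isolating_family.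
set h := \sum_i g i in h0 gE.
have Sh : S h by rewrite /h; elim/big_ind : _ => //; [exact: fractions0S|exact: fractionsDS].
have mem_e (i : 'I_l) : class_indicator i \in seq_fractions.
  by apply/asboolP; exists (g i), h.
pose e (i : 'I_l) : fraction_subalg := @SdaElt _ _ fraction_subalg _ (mem_e i).
apply: (@pseudo_field_of_idempotents fraction_subalg l e).
- by move=> i; apply: val_inj; exact: class_indicator_idem.
- by move=> i j ij; apply: val_inj; exact: class_indicator_orth.
- apply: sda_incl_inj; rewrite rmorph1 raddf_sum /=; apply/eqP; rewrite -subr_eq0; apply/eqP.
  apply: (seq_nonvanishing_reg h0); rewrite mulrBl mul1r mulr_suml /=.
  by under eq_bigr do rewrite gE; rewrite subrr.
- by move=> i; apply: val_inj; exact: class_indicator_sigma.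
move=> i; split.
  (* A zero idempotent would make [g i] vanish on its own class. *)
  move=> /(congr1 val) /= ei0; have := gE i; rewrite ei0 mul0r => gi0.
  have := suppg i (l - i)%N; rewrite -gi0 subnK ?dvdnn; last exact: ltnW.
  by move=> /(_ (vanishes_on0 _ _ _)).
move=> x [x' xE] x0.
have /asboolP[r [s [Sr Ss s0 xs]]] := sda_valP x'.
have ncr : ~ vanishes_on (l - i) l r.
  move=> cr; apply: x0; rewrite xE; apply: sda_incl_inj; rewrite rmorphM rmorph0.
  apply: (seq_nonvanishing_reg s0); rewrite -mulrA [sda_incl x' * s]xs.
  by apply: class_indicatorM_eq0 cr; rewrite subnK // ltnW.
set ei := class_indicator i.
(* This sequence is [r] on the class of [- i] and 1 elsewhere. *)
have u0 : seq_nonvanishing (ei * (r - 1) + 1).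
  have sE := eventually_all_and (seq_reprD (ei * (r - 1)) 1)
    (eventually_all_and (seq_repr1 k) (class_indicatorM i (r - 1))).
  have rE := seq_reprB r 1.
  have nr := nonvanishing_on_class Ssigma Sper stable_l Sr ncr.
  apply: eventually_all2 (eventually_all_and sE rE) nr _.
  move=> m [[-> [one ->]] ->]; rewrite one.
  have [mi|_ _] := boolP (l %| m + i)%N; last by rewrite mul0r add0r oner_eq0.
  rewrite mul1r subrK; apply; apply/eqP.
  by rewrite -(eqn_modDr i) subnK ?modnn // ltnW.
have eg : ei * g i = g i by rewrite -gE mulrA class_indicator_idem.
(* Multiplication by [h] clears the denominator of the indicator: the unit [r'] lies in [S], so its
   inverse is a fraction. *)
pose r' := r * g i + (h - g i).
have r'E : r' = (ei * (r - 1) + 1) * h by rewrite /r' -(gE i) -/ei; ring.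
have Sr' : S r' by apply: fractionsDS; [exact: SM|exact: SB].
have /seq_nonvanishingP[t r't] : seq_nonvanishing r' by rewrite r'E; exact: seq_nonvanishingM.
have yL : s * h * t \in seq_fractions.
  have [_ _ LM] := seq_fractions_subring.
  by apply: LM; [apply: seq_fractions_sub; exact: SM|exact: seq_fractions_inv Sr' r't].
pose y : fraction_subalg := @SdaElt _ _ fraction_subalg _ yL.
exists (e i * y); first by exists y.
apply: sda_incl_inj; rewrite xE; transitivity (ei * sda_incl x' * (ei * (s * h * t))); first by [].
have -> : ei * (sda_incl x' : SeqRing k) * (ei * (s * h * t)) = ei * h * (sda_incl x' * s) * t * ei by ring.
rewrite [sda_incl x' * s]xs [ei * h]gE -[RHS]mulr1 -r't /r'.
transitivity (g i * r * t * ei); first by [].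
have -> : ei * ((r * g i + (h - g i)) * t) = (r * (ei * g i) + (ei * h - ei * g i)) * t by ring.
rewrite eg [ei * h]gE subrr addr0 -[in RHS]eg; ring.
Qed.

(** If [s] vanished on a class, the nonzero [g i] supported there would annihilate it. *)
Lemma fraction_nonzerodivisor s : S s -> (forall t, S t -> t * s = 0 -> t = 0) ->
  seq_nonvanishing s.
Proof.
move=> Ss reg; have [g [Sg suppg h0 gE]] := isolating_family.
apply: (nonvanishing_of_classes Ssigma Sper stable_l Ss) => c cs.
have [i ci] := ord_dvdn_surj c; have gi0 : g i = 0.
  by apply: reg => //; rewrite -gE mulrAC (class_indicatorM_eq0 ci cs) mul0r.
by have := suppg i c; rewrite gi0 ci => /(_ (vanishes_on0 _ _ _)).
Qed.

End Fractions.

(** * Orbits as sequences *)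

Lemma rmorph_mmap (m : nat) (R : nzRingType) (S T : comNzRingType)
    (g : {rmorphism S -> T}) (f : R -> S) (h : 'I_m -> S) (p : {mpoly R[m]}) :
  g (mmap f h p) = mmap (g \o f) (g \o h) p.
Proof.
rewrite /mmap rmorph_sum; apply: eq_bigr => mu _; rewrite rmorphM /=; congr (_ * _).
by rewrite /mmap1 rmorph_prod; apply: eq_bigr => i _; rewrite rmorphXn.
Qed.

Lemma mmap_mem (m : nat) (R : nzRingType) (S : comNzRingType)
    (L : subringClosed S) (f : R -> S) (h : 'I_m -> S) (p : {mpoly R[m]}) :
  (forall c, f c \in L) -> (forall i, h i \in L) -> mmap f h p \in L.
Proof.
move=> fL hL; rewrite /mmap rpred_sum // => mu _; rewrite rpredM //.
by rewrite /mmap1 rpred_prod // => i _; rewrite rpredX.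
Qed.

Section OrbitSequences.
Variables (k : fieldType) (k0 : [pchar k] =i pred0) (n : nat) (A : 'M[ratfun k]_n).
Variables (b : nat) (x : k * 'M[k]_n).
Hypothesis xb : x.1 = b%:R.
Hypothesis orb_x : orbit_defined A x.

Local Notation const := (fun c : k => rat_seq (FracField.tofrac c%:P)).

(** Named so as to carry a ring morphism structure: polynomials and determinants of sequences are
    then computed index by index. *)
Definition fun_eval (m : nat) (f : nat -> k) : k := f m.

HB.instance Definition _ m :=
  GRing.isZmodMorphism.Build (nat -> k) k (fun_eval m) (fun _ _ => erefl).
HB.instance Definition _ m :=
  GRing.isMonoidMorphism.Build (nat -> k) k (fun_eval m) (conj erefl (fun _ _ => erefl)).

(* Indexed so that the first coordinate at time [m] is [m] itself, as soon as
   [b <= m]. *)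
Definition orbit_pt (m : nat) : k * 'M[k]_n := iter (m - b) (Xsigma A) x.

Definition orbit_mx : 'M[SeqRing k]_n :=
  \matrix_(i, j) seq_class (fun m => (orbit_pt m).2 i j).

Definition orbit_fun (f : regular_fun k n) : SeqRing k :=
  seq_class (fun m => regular_fun_eval f (orbit_pt m)).

Definition orbit_detV : SeqRing k := seq_class (fun m => (\det (orbit_pt m).2)^-1).

(** The argument vector of [regular_fun_eval], with sequences as entries. *)
Definition orbit_coord (i : 'I_(1 + (n * n + 1))) : SeqRing k :=
  row_mx (rat_seq (FracField.tofrac 'X))%:M
    (row_mx (mxvec orbit_mx) orbit_detV%:M) 0 i.

Lemma rat_seq_const (c : k) : rat_seq (FracField.tofrac c%:P) = seq_class (fun=> c).
Proof.
apply/seq_classP; exists 0%N => i _; rewrite (@rat_evalE _ c%:P 1).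
- by rewrite !hornerC divr1.
- by rewrite hornerC oner_neq0.
- by rewrite tofrac1 divr1.
Qed.

Lemma rat_seq_poly (d : {poly k}) : rat_seq (FracField.tofrac d) = seq_class (fun m => d.[m%:R]).
Proof.
apply/seq_classP; exists 0%N => i _; rewrite (@rat_evalE _ d 1).
- by rewrite !hornerC divr1.
- by rewrite hornerC oner_neq0.
- by rewrite tofrac1 divr1.
Qed.

Lemma orbit_ptS m : (b <= m)%N -> orbit_pt m.+1 = Xsigma A (orbit_pt m).
Proof. by move=> bm; rewrite /orbit_pt subSn. Qed.

Lemma orbit_pt1 m : (b <= m)%N -> (orbit_pt m).1 = m%:R.
Proof.
move=> /subnKC <-; elim: (m - b)%N => [|i IH]; first by rewrite addn0 /orbit_pt subnn.
by rewrite addnS orbit_ptS ?leq_addr //= IH natr1.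
Qed.

Lemma orbit_mxE : orbit_mx = map_mx (@seq_class k) (\matrix_(i, j) fun m => (orbit_pt m).2 i j).
Proof. by apply/matrixP => i j; rewrite !mxE. Qed.

(** Evaluation at an index and passage to classes are ring morphisms, so both commute with
    polynomials; the coordinate [z] agrees with the index from [b] on. *)
Lemma orbit_funE f : orbit_fun f = mmap const orbit_coord f.
Proof.
pose v (i : 'I_(1 + (n * n + 1))) (m : nat) : k :=
  row_mx (orbit_pt m).1%:M (row_mx (mxvec (orbit_pt m).2) (\det (orbit_pt m).2)^-1%:M) 0 i.
have -> : orbit_fun f = seq_class (mmap (fun c _ => c) v f).
  congr seq_class; apply/funext => m; rewrite -[RHS]/(fun_eval m _).
  by rewrite rmorph_mmap.
rewrite rmorph_mmap /mmap; apply: eq_bigr => mu _ /=.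
rewrite rat_seq_const; congr (_ * _); apply: mmap1_eq => i /=.
rewrite /orbit_coord /v; case: (split_ordP i) => a ->; rewrite ?row_mxEl ?row_mxEr.
  rewrite !ord1 mxE eqxx mulr1n rat_seq_poly; apply/seq_classP; exists b => m bm.
  by rewrite row_mxEl mxE eqxx mulr1n hornerX orbit_pt1.
case: (split_ordP a) => c ->; rewrite ?row_mxEl ?row_mxEr.
  case/mxvec_indexP: c => a1 a2; rewrite mxvecE mxE; congr seq_class.
  by apply/funext => m; rewrite row_mxEr row_mxEl mxvecE.
rewrite !ord1 mxE eqxx mulr1n; congr seq_class.
by apply/funext => m; rewrite !row_mxEr mxE eqxx mulr1n.
Qed.

Lemma orbit_det_mulV : \det orbit_mx * orbit_detV = 1.
Proof.
rewrite orbit_mxE det_map_mx -seq_classM -seq_class1; apply/seq_classP; exists 0%N => m _.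
rewrite -[LHS]/(fun_eval m _ * _) -det_map_mx.
have -> : map_mx (fun_eval m) (\matrix_(i, j) fun m => (orbit_pt m).2 i j) = (orbit_pt m).2.
  by apply/matrixP => i j; rewrite !mxE.
(* Truncated subtraction makes [orbit_pt m] a point of the orbit for [m < b] too, so its determinant
   is never zero. *)
by rewrite mulfV // -unitfE -unitmxE; have [] := orb_x (m - b)%N.
Qed.

Lemma orbit_mx_sigma :
  map_mx dsigma orbit_mx = map_mx (@rat_seq k) A *m orbit_mx.
Proof.
apply/matrixP => i j; rewrite !mxE [LHS]seq_sigmaE.
under eq_bigr do rewrite !mxE -seq_classM.
rewrite -(raddf_sum (@seq_class k)); apply/seq_classP; exists b => m bm.
rewrite orbit_ptS // /Xsigma /= fct_sumE mxE; apply: eq_bigr => a _.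
by rewrite mxE orbit_pt1.
Qed.

End OrbitSequences.

(** * From Picard-Vessiot extensions to return sets *)

(** Translates between iteration counts and the indices of [orbit_pt], which are larger by [b]. *)
Lemma eventually_periodic_add (S : set nat) (b : nat) :
  eventually_periodic (fun i => S (i + b)%N) <-> eventually_periodic S.
Proof.
split=> -[l l0 [N hN]]; exists l => //.
  exists (N + b)%N => i Ni; have bi : (b <= i)%N by apply: leq_trans Ni; exact: leq_addl.
  have := hN (i - b)%N; rewrite addnAC subnK //; apply.
  by rewrite leq_subRL // addnC.
by exists N => i Ni; rewrite addnAC; apply: hN; rewrite (leq_trans Ni) ?leq_addr.
Qed.

Lemma seq_repr_iter_sigma (k : fieldType) (l : nat) (s : SeqRing k) :
  eventually_all (fun m => seq_repr (iter l dsigma s) m = seq_repr s (m + l)).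
Proof.
elim: l => [|l IH]; first by exists 0%N => m _; rewrite addn0.
apply: eventually_all2 (seq_repr_sigma (iter l dsigma s)) (eventually_allS IH) _ => m.
by rewrite iterS addSnnS => -> ->.
Qed.

Lemma iter_ordS (T : Type) (f : T -> T) (l : nat) (e : 'I_l -> T) (i : 'I_l) :
  (forall i, f (e i) = e (ordS i)) -> iter l f (e i) = e i.
Proof.
move=> fe; suff iterE j : iter j f (e i) = e (iter j (@ordS l) i).
  rewrite iterE; congr e; apply: val_inj.
  have valE j : val (iter j (@ordS l) i) = ((i + j) %% l)%N.
    elim: j => [|j IH]; first by rewrite addn0 modn_small.
    by rewrite iterS /= [X in X.+1]IH addnS -[in LHS]addn1 modnDml addn1.
  by rewrite valE modnDr modn_small.
by elim: j => //= j ->; rewrite fe.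
Qed.

Section PseudoFieldZeros.
Variables (k : fieldType) (k0 : [pchar k] =i pred0) (L : subDiffAlg (Seq k0)).

(* The idempotents are eventually 0-1 sequences, periodic since [dsigma] permutes
   them cyclically, and a component of [x] either is zero or vanishes exactly
   where its idempotent does. *)
Lemma pseudo_field_zeros (x : L) : pseudo_field L ->
  eventually_periodic (fun i => seq_repr (sda_incl x : SeqRing k) i = 0).
Proof.
move=> [l [e [eid eorth edec esigma efield]]].
(* Without idempotents, 1 would be an empty sum. *)
have l0 : (0 < l)%N.
  case: l e {eid eorth esigma efield} edec => // e /(_ 1)[f [[_ /eqP]]].
  by rewrite big_ord0 oner_eq0.
have [f [[ef xE] _]] := edec x.
have exf i : e i * x = f i.
  rewrite xE mulr_sumr (bigD1 i) //= big1 => [|j ji].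
    by have [y ->] := ef i; rewrite mulrA eid addr0.
  by have [y ->] := ef j; rewrite mulrA eorth 1?eq_sym // mul0r.
pose E i : SeqRing k := sda_incl (e i); pose F i : SeqRing k := sda_incl (f i).
have Eper : eventually_all (fun m => forall i, seq_repr (E i) (m + l) = seq_repr (E i) m).
  apply: eventually_all_fin => i; have := seq_repr_iter_sigma l (E i).
  suff -> : iter l dsigma (E i) = E i by apply: eventually_allW => m <-.
  apply: (@iter_ordS _ _ l E) => j; by rewrite /E -esigma.
(* A nonzero [f i] is invertible in [e i L], so [F i] and [E i] divide each other and share their
   late zeros. *)
have FE : eventually_all (fun m => forall i, seq_repr (F i) m = 0 <-> f i = 0 \/ seq_repr (E i) m = 0).
  apply: eventually_all_fin => i.
  have [fi0|/eqP fi0] := eqVneq (f i) 0.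
    have -> : F i = 0 by rewrite /F fi0; exact: (rmorph0 (@sda_incl _ _ L)).
    by apply: eventually_allW (seq_repr0 k) => m ->; split=> // _; left.
  have [y _ fy] := (efield i).2 (f i) (ef i) fi0.
  have efi : E i * F i = F i.
    have [z fz] := ef i; rewrite -[LHS]/(sda_incl (e i * f i)) /F fz mulrA eid //.
  have {}fy : F i * sda_incl y = E i by rewrite /E -fy.
  apply: eventually_all2 (seq_reprM (E i) (F i)) (seq_reprM (F i) (sda_incl y)) _ => m.
  rewrite efi fy => E1 E2; split=> [F0|[//|E0]]; first by right; rewrite E2 F0 mul0r.
  by rewrite E1 E0 mul0r.
have xm : eventually_all (fun m => seq_repr (sda_incl x : SeqRing k) m = 0 <->
    forall i, f i = 0 \/ seq_repr (E i) m = 0).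
  have xF : eventually_all (fun m => forall i,
      seq_repr (F i) m = seq_repr (E i) m * seq_repr (sda_incl x : SeqRing k) m).
    apply: eventually_all_fin => i; rewrite /F -exf; exact: seq_reprM.
  have sumF : (sda_incl x : SeqRing k) = \sum_i F i by rewrite xE; exact: (rmorph_sum (@sda_incl _ _ L)).
  have := seq_repr_sum F; rewrite -sumF => xsum.
  apply: eventually_all2 (eventually_all_and xF xsum) FE _ => m [h1 h2] h3.
  split=> [x0 i|h]; first by apply/h3; rewrite h1 x0 mulr0.
  by rewrite h2 big1 // => i _; apply/h3; exact: h.
apply: (@eventually_periodic_ext (fun m => forall i, f i = 0 \/ seq_repr (E i) m = 0)).
  by apply: eventually_allW xm => m ->.
by exists l => //; apply: eventually_allW Eper => m hm; split=> h i; have := h i; rewrite hm.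
Qed.


End PseudoFieldZeros.

Lemma seq_sigma_fixed (k : fieldType) (s : SeqRing k) :
  dsigma s = s -> exists c : k, s = rat_seq (FracField.tofrac c%:P).
Proof.
move=> ss; have [N hN] : eventually_all (fun m => seq_repr s m.+1 = seq_repr s m).
  by have := seq_repr_sigma s; rewrite ss; apply: eventually_allW => m <-.
exists (seq_repr s N); rewrite rat_seq_const -[LHS]seq_reprK; apply/seq_classP.
exists N => i /subnKC <-; elim: (i - N)%N => [|j IH]; first by rewrite addn0.
by rewrite addnS hN // leq_addr.
Qed.

(** [sda_pred L] retyped over [SeqRing k], so that closure under sums and products applies there. *)
Definition seq_mem (k : fieldType) (k0 : [pchar k] =i pred0) (L : subDiffAlg (Seq k0)) :
  {pred SeqRing k} := sda_pred L.

HB.instance Definition _ k k0 L :=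
  GRing.isSubringClosed.Build (SeqRing k) (@seq_mem k k0 L) (sda_subring L).

Section PicardVessiotZeros.
Variables (k : fieldType) (k0 : [pchar k] =i pred0) (n : nat) (A : 'M[ratfun k]_n).
Variables (L : subDiffAlg (Seq k0)).
Hypothesis pvL : is_Picard_Vessiot A L.

(** Write [s] as [r / d] over [K[Y_ij]]. As [s] and [d] are units of the sequence ring, [r] is a
    nonzerodivisor, hence invertible in [L], and [t] is [d / r]. *)
Lemma PV_inverse_mem (s t : SeqRing k) : s \in seq_mem L -> s * t = 1 -> t \in seq_mem L.
Proof.
move=> sL st; have [_ [Y [_ _ [inv frac]]] _] := pvL.
pose s' : L := SdaElt sL.
have [r [d [Sr Sd rE]]] := frac s'.
have [d' dd'] := inv d Sd.
have [|r' rr'] := inv r.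
  split=> // a _ ar; apply: sda_incl_inj; rewrite rmorph0.
  have {ar} : a * s' = 0 by rewrite -[LHS]mulr1 -dd' mulrA -(mulrA a) rE ar mul0r.
  move=> /(congr1 (@sda_incl _ _ L)) as0.
  have {}as0 : (sda_incl a : SeqRing k) * s = 0 by [].
  by rewrite -[LHS]mulr1 -[1]st mulrA [_ * s]as0 mul0r.
have : s * sda_incl (d * r') = 1.
  by rewrite -rE -mulrA in rr'; move/(congr1 (@sda_incl _ _ L)) : rr'.
move=> sdr; have -> : t = sda_incl (d * r').
  by rewrite -[LHS]mulr1 -sdr mulrA (mulrC t) st mul1r.
exact: sda_valP.
Qed.

Variables (b : nat) (x : k * 'M[k]_n).
Hypothesis xb : x.1 = b%:R.
Hypothesis orb_x : orbit_defined A x.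

(** The quotient [C] of the two fundamental matrices is fixed by [dsigma], so its entries are
    constants from [k], and the orbit matrix is [Yv *m C]. *)
Lemma PV_orbit_mx_mem i j : orbit_mx A b x i j \in seq_mem L.
Proof.
have [_ [Y [[Z [YZ ZY]] sY _]] _] := pvL.
pose Yv : 'M[SeqRing k]_n := map_mx (@sda_incl _ _ L) Y.
pose Zv : 'M[SeqRing k]_n := map_mx (@sda_incl _ _ L) Z.
have YZv : Yv *m Zv = 1%:M.
  have := congr1 (map_mx (@sda_incl _ _ L)) YZ; rewrite map_mxM map_mx1; exact.
have ZYv : Zv *m Yv = 1%:M.
  have := congr1 (map_mx (@sda_incl _ _ L)) ZY; rewrite map_mxM map_mx1; exact.
have sYv : map_mx dsigma Yv = map_mx (@rat_seq k) A *m Yv.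
  apply/matrixP => a c; have := congr1 (fun M : 'M[L]_n => sda_incl (M a c)) sY.
  rewrite /= !mxE rmorph_sum => E; transitivity (sda_incl (dsigma (Y a c))); first by [].
  by rewrite E; apply: eq_bigr => d _; rewrite !mxE.
have sZv : map_mx dsigma Zv *m map_mx (@rat_seq k) A = Zv.
  rewrite -[LHS]mulmx1 -YZv mulmxA -(mulmxA _ _ Yv) -sYv -map_mxM ZYv map_mx1.
  by rewrite mul1mx.
pose C := Zv *m orbit_mx A b x.
have sC : map_mx dsigma C = C.
  by rewrite map_mxM orbit_mx_sigma // mulmxA sZv.
have CL a c : C a c \in seq_mem L.
  have [|d ->] := @seq_sigma_fixed _ (C a c); first by have /matrixP/(_ a c) := sC; rewrite [LHS]mxE.
  exact: (sda_map L).
have -> : orbit_mx A b x = Yv *m C by rewrite mulmxA YZv mul1mx.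
by rewrite mxE rpred_sum // => a _; rewrite rpredM ?CL // mxE; exact: sda_valP.
Qed.

Lemma PV_orbit_fun_mem f : orbit_fun A b x f \in seq_mem L.
Proof.
rewrite orbit_funE //; apply: mmap_mem => [c|i]; first exact: (sda_map L).
rewrite /orbit_coord; case: (split_ordP i) => a ->; rewrite ?row_mxEl ?row_mxEr.
  by rewrite !ord1 mxE eqxx mulr1n; exact: (sda_map L).
case: (split_ordP a) => c ->; rewrite ?row_mxEl ?row_mxEr.
  by case/mxvec_indexP: c => a1 a2; rewrite mxvecE PV_orbit_mx_mem.
rewrite !ord1 mxE eqxx mulr1n; apply: PV_inverse_mem (orbit_det_mulV b orb_x).
rewrite /determinant rpred_sum // => s _; rewrite rpredMsign rpred_prod // => a1 _.
exact: PV_orbit_mx_mem.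
Qed.

(** Each equation gives the zero set of an element of [L], and finite intersections stay eventually
    periodic. *)
Lemma PV_return_set_periodic (Y : set (k * 'M[k]_n)) :
  closed_subvariety Y -> eventually_periodic (return_set A x Y).
Proof.
move=> [fs ->]; have [pfL _ _] := pvL.
have h f : eventually_periodic (fun i => regular_fun_eval f (iter i (Xsigma A) x) = 0).
  have h1 : eventually_periodic (fun m => regular_fun_eval f (orbit_pt A b x m) = 0).
    apply: eventually_periodic_ext (pseudo_field_zeros (SdaElt (PV_orbit_fun_mem f)) pfL).
    have := seq_repr_class (fun m => regular_fun_eval f (orbit_pt A b x m)).
    by apply: eventually_allW => m <-.
  apply: eventually_periodic_ext ((eventually_periodic_add _ b).2 h1).
  by exists 0%N => i _; rewrite /orbit_pt addnK.
elim: fs => [|f fs IH].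
  apply: eventually_periodic_ext (eventually_periodic_cst True).
  by exists 0%N => i _; split=> // _; split=> //; have [] := orb_x i.
apply: eventually_periodic_ext (eventually_periodic2 and (h f) IH).
exists 0%N => i _; split=> [[f0 [Xi fs0]]|[Xi fs0]].
  by split=> // g; rewrite inE => /orP[/eqP->|/fs0].
split; first by apply: fs0; rewrite mem_head.
by split=> // g gfs; apply: fs0; rewrite inE gfs orbT.
Qed.

End PicardVessiotZeros.

(** * From return sets to Picard-Vessiot extensions *)

Section MmapImage.
Variables (m : nat) (R S : comNzRingType) (f : {rmorphism R -> S}) (h : 'I_m -> S).

Definition mmap_image : {pred S} := fun t => `[< exists P : {mpoly R[m]}, t = mmap f h P >].

Lemma mmap_image_subring : subring_closed mmap_image.
Proof.
split=> [|s t /asboolP[p ->] /asboolP[q ->]|s t /asboolP[p ->] /asboolP[q ->]].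
- by apply/asboolP; exists 1; rewrite (rmorph1 (mmap f h)).
- by apply/asboolP; exists (p - q); rewrite (rmorphB (mmap f h)).
- by apply/asboolP; exists (p * q); rewrite (rmorphM (mmap f h)).
Qed.

HB.instance Definition _ := GRing.isSubringClosed.Build S mmap_image mmap_image_subring.

Lemma mmap_image_scalar c : f c \in mmap_image.
Proof. by apply/asboolP; exists c%:MP; rewrite mmapC. Qed.

Lemma mmap_image_var i : h i \in mmap_image.
Proof. by apply/asboolP; exists 'X_i; rewrite mmapX mmap1U. Qed.

End MmapImage.

Section FromReturnSets.
Variables (k : fieldType) (k0 : [pchar k] =i pred0) (n : nat) (A : 'M[ratfun k]_n).
Variables (b : nat) (x : k * 'M[k]_n).
Hypothesis xb : x.1 = b%:R.
Hypothesis orb_x : orbit_defined A x.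
Hypothesis return_x : forall Y, closed_subvariety Y ->
  finite_union_of_APs (return_set A x Y).

Local Notation Y := (orbit_mx A b x).
Local Notation S := (mmap_image (rat_seq_rmorphism k0) (fun i => mxvec Y 0 i)).
Local Notation const := ((rat_seq_rmorphism k0 \o (@FracField.tofrac {poly k} \o @polyC k))%FUN
  : {rmorphism k -> SeqRing k}).
(** Regular functions along the orbit: coefficients are polynomial in [z] and the inverse
    determinant is allowed, whereas [S] has coefficients in [k(z)] and only the entries as
    generators. *)
Local Notation E := (mmap_image const (orbit_coord A b x)).

Lemma orbit_fun_image t : t \in E -> exists f, t = orbit_fun A b x f.
Proof. by move=> /asboolP[f ->]; exists f; rewrite orbit_funE. Qed.

Lemma rat_seq_poly_mem (d : {poly k}) : rat_seq (FracField.tofrac d) \in E.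
Proof.
rewrite -[rat_seq _]/((rat_seq_rmorphism k0 \o @FracField.tofrac {poly k}) d).
elim/poly_ind: d => [|d c IH]; first by rewrite rmorph0 rpred0.
rewrite rmorphD rmorphM rpredD ?rpredM //; last exact: (mmap_image_scalar const _ c).
have := mmap_image_var const (orbit_coord A b x) (lshift _ ord0).
by rewrite {1}/orbit_coord row_mxEl mxE eqxx mulr1n.
Qed.

Lemma orbit_mx_entry_mem i : mxvec Y 0 i \in E.
Proof.
have := mmap_image_var const (orbit_coord A b x) (rshift 1 (lshift 1 i)).
by rewrite {1}/orbit_coord row_mxEr row_mxEl.
Qed.

Lemma rat_seq_denom (h : ratfun k) :
  rat_seq (FracField.tofrac (rat_den h)) * rat_seq h = rat_seq (FracField.tofrac (rat_num h)).
Proof.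
have <- : FracField.tofrac (rat_den h) * h = FracField.tofrac (rat_num h).
  by rewrite [X in _ * X]ratE mulrC divfK // tofrac_eq0 rat_den_neq0.
exact: esym (rmorphM (rat_seq_rmorphism k0) _ _).
Qed.

(** The denominator is accumulated term by term from the coefficients in [k(z)]. *)
Lemma clear_denominators t : t \in S -> exists d f,
  d != 0 /\ rat_seq (FracField.tofrac d) * t = orbit_fun A b x f.
Proof.
move=> tS; suff [d [d0 /orbit_fun_image[f E]]] :
    exists d, d != 0 /\ rat_seq (FracField.tofrac d) * t \in E by exists d, f.
have /asboolP[p ->] := tS; elim/mpolyind: p {tS} => [|c mu p _ _ [d [d0 IH]]].
  by exists 1; rewrite oner_neq0 (rmorph0 (mmap _ _)) mulr0 rpred0.
exists (rat_den c * d); split; first by rewrite mulf_neq0 ?rat_den_neq0.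
rewrite mmapD mmapZ mmapX tofracM.
rewrite [rat_seq _](rmorphM (rat_seq_rmorphism k0)) /=.
rewrite mulrDr rpredD //; last by rewrite -mulrA rpredM ?rat_seq_poly_mem.
rewrite mulrACA rat_seq_denom rpredM ?rat_seq_poly_mem // rpredM ?rat_seq_poly_mem //.
by rewrite /mmap1 rpred_prod // => i _; rewrite rpredX // orbit_mx_entry_mem.
Qed.

(** The denominator [d] is nonzero at late indices, so [t] has the late zeros of a regular function
    along the orbit. *)
Lemma entries_zeros_periodic t : t \in S -> eventually_periodic (fun i => seq_repr t i = 0).
Proof.
move=> /clear_denominators[d [f [d0 dt]]].
pose Yf := [set y : k * 'M[k]_n | Xpts y /\ forall g, g \in [:: f] -> regular_fun_eval g y = 0]%classic.
have /finite_union_of_APsP Yfper : finite_union_of_APs (return_set A x Yf).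
  by apply: return_x; exists [:: f].
have h1 : eventually_periodic (fun m => regular_fun_eval f (orbit_pt A b x m) = 0).
  apply/(eventually_periodic_add _ b); apply: eventually_periodic_ext Yfper.
  exists 0%N => i _; rewrite /orbit_pt addnK; split=> [[_ /(_ f)]|fi].
    by apply; rewrite mem_head.
  by split=> [|g]; [have [] := orb_x i|rewrite inE => /eqP->].
apply: eventually_periodic_ext h1.
have dE := poly_nat_neq0 k0 d0.
have tE : eventually_all (fun m => d.[m%:R] * seq_repr t m = regular_fun_eval f (orbit_pt A b x m)).
  by apply/seq_classP; rewrite -/(orbit_fun A b x f) -dt rat_seq_poly -{2}(seq_reprK t) -seq_classM.
apply: eventually_all2 dE tE _ => m dm <-; split=> [/eqP|->]; last by rewrite mulr0.
by rewrite mulf_eq0 (negPf dm) => /eqP.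
Qed.

Lemma entries_sigma t : t \in S -> dsigma t \in S.
Proof.
move=> /asboolP[p ->]; rewrite (rmorph_mmap dsigma); apply: mmap_mem => [c|i] /=.
  by rewrite -[rat_seq c]/(rat_seq_rmorphism k0 c) -rat_seqS; exact: mmap_image_scalar.
case/mxvec_indexP: i => i j; rewrite mxvecE.
have /matrixP/(_ i j) := orbit_mx_sigma A xb; rewrite [LHS]mxE => ->.
rewrite mxE rpred_sum // => a _; apply: rpredM.
  by rewrite mxE; exact: (mmap_image_scalar (rat_seq_rmorphism k0) _ (A i a)).
by rewrite -(mxvecE Y a j); exact: mmap_image_var.
Qed.

(** Factorials form a divisibility chain, so the ideals [I(0, j!)] ascend; pulled back to
    polynomials over [k(z)] they stabilise at some [N]. *)
Lemma stable_period_ex : exists l, stable_period (fun t => t \in S) l /\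
  forall g, stable_period (fun t => t \in S) g -> (l <= g)%N.
Proof.
pose phi : {rmorphism {mpoly (ratfun k)[n * n]} -> SeqRing k} :=
  mmap (rat_seq_rmorphism k0) (fun i => mxvec Y 0 i).
have [||||N hN] := @mpoly_ideal_chain_stable (ratfun k) (n * n)
  (fun j p => vanishes_on 0 j`! (phi p)).
- by move=> j; rewrite (rmorph0 phi); exact: vanishes_on0.
- by move=> j p q; rewrite (rmorphB phi); exact: vanishes_onB.
- by move=> j r p; rewrite (rmorphM phi); exact: vanishes_onM.
- by move=> i j p ij; apply: vanishes_on_sub => //; by rewrite (fact_split ij) dvdn_mulr.
have st : stable_period (fun t => t \in S) N`!.
  split=> [|m s m0 /asboolP[p ->] hs]; first exact: fact_gt0.
  (* Since [m * N!] divides its own factorial, [s] belongs to the stage [m * N!] of the chain, hence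
     to stage [N]. *)
  apply: (hN (m * N`!)%N); first by rewrite (leq_trans (fact_geq _)) // leq_pmull.
  apply: vanishes_on_sub hs => //; apply: dvdn_fact.
  by rewrite muln_gt0 m0 fact_gt0 leqnn.
have ex : exists l, `[< stable_period (fun t => t \in S) l >] by exists N`!; apply/asboolP.
case: (ex_minnP ex) => l /asboolP stl lmin; exists l; split=> // g stg.
by apply: lmin; apply/asboolP.
Qed.

Let Smap h : rat_seq h \in S := mmap_image_scalar (rat_seq_rmorphism k0) _ h.

Let SB s t : s \in S -> t \in S -> s - t \in S.
Proof. exact: rpredB. Qed.

Let SM s t : s \in S -> t \in S -> s * t \in S.
Proof. exact: rpredM. Qed.

Definition PV_fractions : subDiffAlg (Seq k0) :=
  @fraction_subalg k k0 (fun t => t \in S) Smap SB SM entries_sigma.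

Lemma PV_of_return_sets : is_Picard_Vessiot A PV_fractions.
Proof.
have [l [stl lmin]] := stable_period_ex.
have memL t : t \in S -> t \in seq_fractions (fun t => t \in S).
  exact: (seq_fractions_sub k0 Smap).
pose lift t (tS : t \in S) : PV_fractions := @SdaElt _ _ PV_fractions _ (memL t tS).
have entS i : mxvec Y 0 i \in S by exact: mmap_image_var.
have entS' i j : Y i j \in S by rewrite -(mxvecE Y i j).
pose YL : 'M[PV_fractions]_n := \matrix_(i, j) lift (Y i j) (entS' i j).
have YLE i : sda_incl (mxvec YL 0 i) = mxvec Y 0 i.
  by case/mxvec_indexP: i => i j; rewrite !mxvecE mxE.
(* The inclusion identifies [K[Y_ij]] with [S], reducing the fraction conditions to sequences. *)
have adjE t : adjoin_entries YL t <-> (sda_incl t : SeqRing k) \in S.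
  have valE P : (sda_incl (mmap (diffalg_map PV_fractions) (fun i => mxvec YL 0 i) P) : SeqRing k)
      = mmap (rat_seq_rmorphism k0) (fun i => mxvec Y 0 i) P.
    rewrite (rmorph_mmap (@sda_incl _ _ PV_fractions)); apply: eq_bigr => mu _; congr (_ * _).
    by apply: mmap1_eq => i; exact: YLE.
  split=> [[P ->]|/asboolP[P tE]]; first by apply/asboolP; exists P; exact: valE.
  by exists P; apply: sda_incl_inj; rewrite -[LHS]/(sda_incl t : SeqRing k) tE -valE.
split.
- exact: (fraction_pseudo_field k0 Smap SB SM entries_sigma entries_zeros_periodic stl lmin).
- exists YL; split.
  + have detS : \det Y \in S.
      by rewrite /determinant rpred_sum // => s _; rewrite rpredMsign rpred_prod.
    have dL : orbit_detV A b x \in seq_fractions (fun t => t \in S).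
      exact: (seq_fractions_inv k0 Smap detS (orbit_det_mulV b orb_x)).
    pose d : PV_fractions := @SdaElt _ _ PV_fractions _ dL.
    have dE : d * \det YL = 1.
      apply: sda_incl_inj; rewrite rmorphM rmorph1 -det_map_mx.
      have -> : map_mx (@sda_incl _ _ PV_fractions) YL = Y by apply/matrixP => i j; rewrite !mxE.
      by rewrite mulrC; exact: orbit_det_mulV.
    exists (d *: \adj YL); rewrite -scalemxAr -scalemxAl mul_mx_adj mul_adj_mx.
    by rewrite scale_scalar_mx dE.
  + apply/matrixP => i j; apply: sda_incl_inj.
    have YLij a c : (sda_incl (YL a c) : SeqRing k) = Y a c by rewrite [YL a c]mxE.
    have E := congr1 (fun M : 'M_n => M i j) (orbit_mx_sigma A xb).
    rewrite /= [LHS]mxE [RHS]mxE in E.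
    rewrite mxE [LHS](congr1 dsigma (YLij i j)) E mxE.
    rewrite [RHS](rmorph_sum (@sda_incl _ _ PV_fractions)); apply: eq_bigr => a _.
    by rewrite [RHS]rmorphM /= YLij !mxE.
  + split=> [s [/adjE sS sreg]|t].
      have s0 : seq_nonvanishing (sda_incl s : SeqRing k).
        apply: (fraction_nonzerodivisor k0 Smap SB SM entries_sigma entries_zeros_periodic stl lmin sS).
        move=> t tS ts0.
        have /(congr1 (@sda_incl _ _ PV_fractions)) : lift t tS = 0.
          by apply: sreg; [exact/adjE|apply: sda_incl_inj].
        by [].
      have /seq_nonvanishingP[t st] := s0.
      have tL := @seq_fractions_inv k k0 (fun t => t \in S) Smap _ _ sS st.
      by exists (@SdaElt _ _ PV_fractions _ tL); apply: sda_incl_inj.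
    have /asboolP[r [s [rS sS s0 ts]]] := sda_valP t.
    exists (lift r rS), (lift s sS); split; [exact/adjE| |exact: sda_incl_inj].
    split=> [|a _ as0]; first exact/adjE.
    apply: sda_incl_inj; apply: (seq_nonvanishing_reg s0).
    exact: (congr1 (@sda_incl _ _ PV_fractions) as0).
(* A fixed sequence is eventually constant, so it comes from a scalar of [k], which translation
   fixes. *)
- move=> t; split=> [st|[c sc ->]]; last by rewrite -diffalg_mapS sc.
  have [|c tE] := @seq_sigma_fixed _ (sda_incl t : SeqRing k).
    exact: (congr1 (@sda_incl _ _ PV_fractions) st).
  exists (FracField.tofrac c%:P); last exact: sda_incl_inj.
  have -> : FracField.tofrac c%:P = FracField.tofrac c%:P / FracField.tofrac 1.
    by rewrite tofrac1 divr1.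
  rewrite [LHS]rat_sigmaE ?oner_neq0 // /translate comp_polyC.
  by rewrite rmorph1.
Qed.

End FromReturnSets.

(** * Existence of a defined orbit, and the equivalence *)

Lemma defined_orbit_ex (k : fieldType) (k0 : [pchar k] =i pred0) (n : nat)
    (A : 'M[ratfun k]_n) : A \in unitmx ->
  exists x : k * 'M[k]_n,
    [/\ Xpts x, (exists b : nat, x.1 = b%:R) & orbit_defined A x].
Proof.
rewrite unitmxE unitfE => detA.
have num0 : rat_num (\det A) != 0.
  by apply: contraNneq detA => E; rewrite [\det A]ratE E tofrac0 mul0r.
have rA : eventually_all (fun m => forall ij : 'I_n * 'I_n, regular_at (A ij.1 ij.2) m%:R).
  by apply: eventually_all_fin => ij; exact: regular_nat.
(* Because of the junk values at poles, evaluation commutes with the determinant only eventually;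
   this holds as [rat_seq] is a ring morphism. *)
have detE : eventually_all (fun m => rat_eval (\det A) m%:R = \det (map_mx (rat_eval^~ m%:R) A)).
  apply/seq_classP; rewrite -[LHS]/(rat_seq_rmorphism k0 (\det A)) -det_map_mx.
  have -> : map_mx (rat_seq_rmorphism k0) A =
      map_mx (@seq_class k) (map_mx (fun h m => rat_eval h m%:R) A).
    by apply/matrixP => i j; rewrite !mxE.
  rewrite det_map_mx; congr seq_class; apply/funext => m.
  rewrite -[LHS]/(fun_eval m _) -det_map_mx; congr (\det _).
  by apply/matrixP => i j; rewrite !mxE.
have dA : eventually_all (fun m => rat_eval (\det A) m%:R != 0).
  apply: eventually_all2 (poly_nat_neq0 k0 num0) (regular_nat k0 (\det A)) _ => m nm dm.
  by rewrite mulf_neq0 // invr_neq0.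
(* From [b] on, [A] has no poles and its determinant no zeros at natural numbers, so the orbit of
   the identity matrix over [b] never leaves the domain. *)
have [b hb] := eventually_all_and rA (eventually_all_and detE dA).
have unit1 : (1%:M : 'M[k]_n) \in unitmx by exact: unitmx1.
exists (b%:R, 1%:M); split=> //; first by exists b.
move=> i; have [xi ui] : (iter i (Xsigma A) (b%:R, 1%:M)).1 = (b + i)%:R /\
    (iter i (Xsigma A) (b%:R, 1%:M)).2 \in unitmx.
  elim: i => [|i [IH1 IH2]]; first by rewrite addn0.
  rewrite iterS /= IH1 addnS natr1; split=> //; rewrite unitmx_mul IH2 andbT.
  by have [_ [E d0]] := hb (b + i)%N (leq_addr _ _); rewrite unitmxE unitfE -E.
have [ri [_ di]] := hb (b + i)%N (leq_addr _ _).
by split=> //; rewrite xi // => a c; exact: (ri (a, c)).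
Qed.

Theorem theorem3p1 (k : fieldType) (k0 : [pchar k] =i pred0) (n : nat)
    (hn : (0 < n)%N) (A : 'M[ratfun k]_n) (hA : A \in unitmx) :
  [<->
    (forall x : k * 'M[k]_n,
       Xpts x -> (exists b : nat, x.1 = b%:R) -> orbit_defined A x ->
       forall Y, closed_subvariety Y ->
         finite_union_of_APs (return_set A x Y));
    (exists x : k * 'M[k]_n,
       [/\ Xpts x, (exists b : nat, x.1 = b%:R), orbit_defined A x &
        forall Y, closed_subvariety Y ->
          finite_union_of_APs (return_set A x Y)]);
    (exists L : subDiffAlg (Seq k0), is_Picard_Vessiot A L)].
Proof.
tfae.
- move=> h; have [x [Xx bx ox]] := defined_orbit_ex k0 hA.
  by exists x; split=> //; exact: h.
- move=> [x [_ [b xb] ox hx]]; exists (PV_fractions k0 A xb).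
  exact: PV_of_return_sets.
- move=> [L pvL] x _ [b xb] ox Y cY; apply/finite_union_of_APsP.
  exact: (PV_return_set_periodic pvL xb ox cY).
Qed.
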